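(* Let $\lambda=m\varpi_j$ be a rectangular weight of type $A_n$ ($1\le j\le n$). Then the diagram $$\begin{array}{ccc} B^{h}(\lambda)&\xrightarrow{\ \varphi\ }&\mathrm{SSYT}(\lambda)\\ {\scriptstyle \mathrm{pr}}\downarrow& &\downarrow{\scriptstyle\mathrm{pr}}\\ B^{h}(\lambda)&\xrightarrow{\ \varphi\ }&\mathrm{SSYT}(\lambda)\end{array}$$ is a commutative diagram (of well-defined maps); that is, for every $M\in B^h(\lambda)$ one has $\mathrm{pr}(M)\in B^h(\lambda)$ and $\varphi(\mathrm{pr}(M))=\mathrm{pr}(\varphi(M))$.
   Context: **Modules.** $\mathrm{Q}$ is the quiver of type $A_n$ with vertices $1,\dots,n$ and arrows $i+1\to i$; $\widetilde{\mathrm{Q}}$ is the quiver of type $A_{n+1}$ with the same orientation convention. Modules are finite dimensional representations over $\mathbb{C}$. $M(r,s)$, $r\le s$, is the indecomposable module with dimension vector $\alpha_r+\cdots+\alpha_s$, and $\mu_{r,s}(M)$ its multiplicity in $M$. $\varpi_j$ is the $j$-th fundamental weight, $h_i$ the simple coroots, $m\in\mathbb{Z}_{\ge0}$. For this orientation, for a $\mathbb{C}\mathrm{Q}$-module $M$ and $i\le s\le n$, $$F_i^{\vee}(M,M(i,s))=\sum_{k=s}^n\mu_{i,k}(M)-\sum_{k=s}^{n-1}\mu_{i+1,k+1}(M),$$ and $B^h(\lambda)$ is the set of isomorphism classes of $\mathbb{C}\mathrm{Q}$-modules $M$ with $F_i^\vee(M,M(i,s))\le\lambda(h_i)$ for all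 $1\le i\le s\le n$. For $\widetilde{\mathrm{Q}}$-modules $F_i^\vee$ is given by the same formula with $n$ replaced by $n+1$. For $M\in B^h(\lambda)$ one has $\mu_{r,s}(M)=0$ unless $1\le r\le j$ and $r\le s\le n-j+r$. **Extended array.** For $M\in B^h(\lambda)$ put $k_i=m-\dim\operatorname{Hom}_{\mathbb{C}\mathrm{Q}}(S(i),M)=m-\sum_{s\ge i}\mu_{i,s}(M)\ge0$ for $1\le i\le j$. $M^{\mathrm{ext}}$ is the $\mathbb{C}\widetilde{\mathrm{Q}}$-module with multiplicities, for $1\le r\le j$, $r\le s\le n+1-j+r$, $\mu_{r,s}(M^{\mathrm{ext}})=\mu_{r,s-1}(M)$ if $r\neq s$ and $\mu_{r,r}(M^{\mathrm{ext}})=k_r$; all other multiplicities are $0$. **Promotion on modules.** Let $N$ be a $\mathbb{C}\widetilde{\mathrm{Q}}$-module. For $1\le i<j$ let $s_0$ be the largest $s\in\{i,\dots,n+1\}$ for which $F_i^\vee(N,M(i,s))$ is maximal, and put $W_N=M(i,s_0)$ and $E_N=M(i+1,s_0)$ (with $E_N=0$ if $s_0=i$). Define $T_i(N)=N$ if $W_N$ is not a direct summand of $N$, and $T_i(N)=N'\oplus E_N$ where $N=N'\oplus W_N$ otherwise. Define $\mathrm{sh}_j(N)=N$ if $M(j,n+1)$ is not a direct summand of $N$, and $\mathrm{sh}_j(N)=N''$ where $N=N''\oplus M(j,n+1)$ otherwise. Set $$\widetilde{\mathrm{pr}}(N)=(T_1\circ\cdots\circ T_{j-1}\circ\mathrm{sh}_j)^{\mu_{j,n+1}(N)}(N).$$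 For $M\in B^h(\lambda)$, $\mathrm{pr}(M)$ is the $\mathbb{C}\mathrm{Q}$-module with $\mu_{r,s}(\mathrm{pr}(M))=\mu_{r,s}(\widetilde{\mathrm{pr}}(M^{\mathrm{ext}}))$ for $1\le r\le j$, $r\le s\le n-j+r$, and all other multiplicities $0$. **Tableaux.** $\mathrm{SSYT}(\lambda)$ is the set of semistandard Young tableaux of rectangular shape with $j$ rows of length $m$ in the alphabet $1\prec2\prec\cdots\prec n+1$ (rows weakly increasing, columns strictly increasing downwards). $\varphi:B^h(\lambda)\to\mathrm{SSYT}(\lambda)$ is the bijection determined by: for $1\le r\le j$ and $r\le s\le n-j+r$, $\mu_{r,s}(M)$ is the number of letters $s+1$ in row $r$ of $\varphi(M)$ (the remaining boxes of row $r$ contain $r$, and rows are weakly increasing). The promotion operator $\mathrm{pr}$ on $\mathrm{SSYT}(\lambda)$: remove all letters $n+1$ from $T$; add $1$ to every remaining letter; slide the letters by jeu-de-taquin into the empty boxes (for each empty box, from left to right, repeatedly move into it the larger of its left and upper neighbours, the upper one in case of equality, until there is no letter to its left or above), so that the empty boxes end up at the left of the first row; finally fill the empty boxes with $1$'s. *)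

(* Defs.v *)
From HB Require Import structures.
From mathcomp Require Import all_boot all_order all_algebra.
From mathcomp Require Import boolp reals.
From mathcomp Require Export complex.

Set Implicit Arguments.
Unset Strict Implicit.
Unset Printing Implicit Defensive.

Import Order.TTheory GRing.Theory Num.Theory.
Local Open Scope ring_scope.

Record quiver := Quiver {
  vertex : finType;
  arrow : finType;
  src : arrow -> vertex;
  tgt : arrow -> vertex }.

Section Representations.
Variables (K : fieldType) (Q : quiver).

Record rep := Rep {
  rep_space :> vertex Q -> vectType K;
  rep_map : forall a : arrow Q, 'Hom(rep_space (src a), rep_space (tgt a)) }.

Definition is_hom (M N : rep) (f : forall v, 'Hom(M v, N v)) : Prop :=
  forall a, (f (tgt a) \o rep_map M a = rep_map N a \o f (src a))%VF.

Definition rep_iso (M N : rep) : Prop :=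
  exists f : forall v, 'Hom(M v, N v),
    is_hom f /\ forall v, bijective (f v).

(* dim Hom(M, N), as the maximal size of a linearly independent family of
   homomorphisms; the strict bound on [d] only serves to make the range of the
   maximum finite. *)
Definition hom_dim (M N : rep) : nat :=
  \max_(d < (\sum_v \dim {:M v} * \dim {:N v}).+1 |
      `[< exists f : 'I_d -> forall v, 'Hom(M v, N v),
            (forall i, is_hom (f i)) /\
            (forall c : 'I_d -> K, (forall v, \sum_i c i *: f i v = 0) ->
               forall i, c i = 0) >]) d.

Definition rep0 : rep :=
  @Rep (fun _ => 'rV[K]_0 : vectType K) (fun _ => 0).

Definition dsum (M N : rep) : rep :=
  @Rep (fun v => (M v * N v)%type : vectType K)
    (fun a => linfun (fun x : M (src a) * N (src a) =>
       (rep_map M a x.1, rep_map N a x.2))).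

Definition rep_pow (M : rep) (k : nat) : rep := iter k (dsum M) rep0.

Definition summand (W N : rep) : Prop := exists N', rep_iso N (dsum N' W).

(* A complement of [W] in [N]; it is unique up to isomorphism by the
   Krull-Schmidt theorem. *)
Definition complement (W N : rep) (h : summand W N) : rep := sval (cid h).

Definition exchange (W E N : rep) : rep :=
  match pselect (summand W N) with
  | left h => dsum (complement h) E
  | right _ => N
  end.

Definition remove (W N : rep) : rep :=
  match pselect (summand W N) with
  | left h => complement h
  | right _ => N
  end.

(* Krull-Schmidt multiplicity of an indecomposable [X] in [N]: the largest [k]
   such that [X]^k is a direct summand of [N]. As [X] is nonzero, such a [k] is
   at most the total dimension of [N]. *)
Definition mult (X N : rep) : nat :=
  \max_(k < (\sum_v \dim {:N v}).+1 | `[< summand (rep_pow X k) N >]) k.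

End Representations.

(* The ordinal [v] stands for the vertex v + 1; the arrows are
   n -> n-1 -> ... -> 2 -> 1. *)
Definition quiverA (n : nat) : quiver :=
  @Quiver 'I_n {e : 'I_n * 'I_n | e.1 == e.2.+1 :> nat}
    (fun a => (sval a).1) (fun a => (sval a).2).

Section TypeA.
Variable K : fieldType.

(* M(r,s), 1 <= r <= s <= n: the ground field at the vertices r, ..., s (the
   booleans below are 0/1 dimensions) and identity maps between them, since
   [const_mx 1 : 'M_1] is the identity matrix. *)
Definition Mrs (n r s : nat) : rep K (quiverA n) :=
  @Rep K (quiverA n)
    (fun v : 'I_n => 'rV[K]_(r <= v.+1 <= s)%N : vectType K)
    (fun a => linfun (mulmxr (const_mx 1))).

Definition mu (n : nat) (M : rep K (quiverA n)) (r s : nat) : nat :=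
  mult (Mrs n r s) M.

Definition rep_of_mults (n : nat) (c : nat -> nat -> nat) : rep K (quiverA n) :=
  \big[@dsum K _/@rep0 K _]_(1 <= r < n.+1)
  \big[@dsum K _/@rep0 K _]_(r <= s < n.+1) rep_pow (Mrs n r s) (c r s).

(* F_i^vee(M, M(i,s)) for M a module over the quiver of type A_n. *)
Definition Fvee (n : nat) (M : rep K (quiverA n)) (i s : nat) : int :=
  \sum_(s <= k < n.+1) (mu M i k)%:Z - \sum_(s <= k < n) (mu M i.+1 k.+1)%:Z.

(* A weight is given by its values on the simple coroots h_1, ..., h_n. *)
Definition weight := nat -> int.

Definition fund_weight (j : nat) : weight := fun i => (i == j)%:R.

Definition rect_weight (m j : nat) : weight := fun i => fund_weight j i *+ m.

Definition Bh (n : nat) (lambda : weight) (M : rep K (quiverA n)) : Prop :=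
  forall i s : nat, (1 <= i)%N -> (i <= s)%N -> (s <= n)%N ->
    Fvee M i s <= lambda i.

(* The subtraction is not truncated when M lies in B^h(m varpi_j). *)
Definition kdef (n m : nat) (M : rep K (quiverA n)) (i : nat) : nat :=
  (m - hom_dim (Mrs n i i) M)%N.

Definition ext_rep (n m j : nat) (M : rep K (quiverA n)) :
    rep K (quiverA n.+1) :=
  rep_of_mults n.+1 (fun r s =>
    if [&& 1 <= r, r <= j, r <= s & s <= n.+1 - j + r]%N
    then if r == s then kdef m M r else mu M r s.-1
    else 0%N).

(* The largest s in {i, ..., p} at which F_i^vee(N, M(i,s)) is maximal. *)
Definition s_max (p i : nat) (N : rep K (quiverA p)) : nat :=
  \max_(i <= s < p.+1 |
      all (fun t => Fvee N i t <= Fvee N i s) (index_iota i p.+1)) s.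

Definition Tmod (p i : nat) (N : rep K (quiverA p)) : rep K (quiverA p) :=
  let s0 := s_max i N in
  exchange (Mrs p i s0)
    (if s0 == i then @rep0 K _ else Mrs p i.+1 s0) N.

Definition shmod (p j : nat) (N : rep K (quiverA p)) : rep K (quiverA p) :=
  remove (Mrs p j p) N.

(* [iota 1 j.-1] is 1, ..., j-1, so the [foldr] is
   T_1 o ... o T_{j-1} o sh_j; here p = n + 1. *)
Definition pr_tilde (p j : nat) (N : rep K (quiverA p)) : rep K (quiverA p) :=
  iter (mu N j p)
    (fun N' => foldr (fun i X => Tmod i X) (shmod j N') (iota 1 j.-1)) N.

Definition pr_mod (n m j : nat) (M : rep K (quiverA n)) : rep K (quiverA n) :=
  let N := pr_tilde j (ext_rep m j M) in
  rep_of_mults n (fun r s =>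
    if [&& 1 <= r, r <= j, r <= s & s <= n - j + r]%N then mu N r s else 0%N).

End TypeA.

(* Fillings of the rectangle with j rows of length m; the matrix entry (r, c)
   is the box in row r + 1 and column c + 1. *)
Definition ssyt (n j m : nat) (T : 'M[nat]_(j, m)) : Prop :=
  [/\ forall r c, (1 <= T r c <= n.+1)%N,
      forall r (c c' : 'I_m), (c <= c')%N -> (T r c <= T r c')%N
    & forall (r r' : 'I_j) c, (r < r')%N -> (T r c < T r' c)%N].

Definition phi_row (K : fieldType) (n m j : nat) (M : rep K (quiverA n))
    (r : nat) : seq nat :=
  nseq (m - \sum_(r <= s < (n - j + r).+1) mu M r s)%N r ++
  flatten [seq nseq (mu M r s) s.+1 | s <- index_iota r (n - j + r).+1].

Definition phi (K : fieldType) (n m j : nat) (M : rep K (quiverA n)) :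
    'M[nat]_(j, m) :=
  \matrix_(r < j, c < m) nth 0%N (phi_row m j M r.+1) c.

(* During the slides a filling is a function of the (0-based) row and column;
   [None] is an empty box. *)
Definition filling := nat -> nat -> option nat.

Definition set_box (T : filling) (r c : nat) (x : option nat) : filling :=
  fun r' c' => if (r' == r) && (c' == c) then x else T r' c'.

Definition left_box (T : filling) (r c : nat) : option nat :=
  if c is c'.+1 then T r c' else None.

Definition upper_box (T : filling) (r c : nat) : option nat :=
  if r is r'.+1 then T r' c else None.

(* Slide for the empty box (r, c), with at most [fuel] moves. *)
Fixpoint slide (fuel : nat) (T : filling) (r c : nat) : filling :=
  if fuel is fuel'.+1 then
    let from_left x := slide fuel'
      (set_box (set_box T r c (Some x)) r c.-1 None) r c.-1 in
    let from_above y := slide fuel'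
      (set_box (set_box T r c (Some y)) r.-1 c None) r.-1 c in
    match left_box T r c, upper_box T r c with
    | None, None => T
    | Some x, None => from_left x
    | None, Some y => from_above y
    | Some x, Some y => if (x <= y)%N then from_above y else from_left x
    end
  else T.

(* Each move decreases r + c, so r + c moves are enough. *)
Definition slide_box (T : filling) (b : nat * nat) : filling :=
  slide (b.1 + b.2) T b.1 b.2.

Definition remove_and_shift (n j m : nat) (T : 'M[nat]_(j, m)) : filling :=
  fun r c =>
    match insub r : option 'I_j, insub c : option 'I_m with
    | Some r', Some c' => if T r' c' == n.+1 then None else Some (T r' c').+1
    | _, _ => None
    end.

(* The empty boxes inside the rectangle, from left to right. *)
Definition empty_boxes (j m : nat) (T : filling) : seq (nat * nat) :=
  [seq b <- [seq (r, c) | c <- iota 0 m, r <- iota 0 j] | T b.1 b.2 == None].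

Definition pr_tab (n j m : nat) (T : 'M[nat]_(j, m)) : 'M[nat]_(j, m) :=
  let T0 := remove_and_shift n T in
  let T1 := foldl slide_box T0 (empty_boxes j m T0) in
  \matrix_(r < j, c < m) odflt 1%N (T1 r c).

(* Main.v *)
Require Import Defs.
From HB Require Import structures.
From mathcomp Require Import all_boot all_order all_algebra.
From mathcomp Require Import boolp reals.
From mathcomp Require Import complex.
From mathcomp Require Import zify.

(** The multiplicities of M^ext list the letters of phi(M): row i of the
    tableau contains mu_{i,s}(M^ext) letters s, for all s >= i. With this
    dictionary, both promotions perform the same moves, box by box.

    On the module side nothing but multiplicities is ever used, so the first
    task is to compute with them. For the linear orientation the multiplicity of
    M(r,s) is a difference of dimensions of subspaces of the space at r: let
    [out_ker] be the kernel of the arrow leaving r, and intersect it with the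
    image of the path from s, respectively from s + 1. This difference is
    additive on direct sums and invariant under isomorphism, and equals 1 on
    M(r,s) and 0 on the other M(r',s'); when it is positive, M(r,s) splits off
    ([summand_Mrs]). Hence it is the multiplicity ([mult_rank_mu]), multiplicities
    are additive, and the operations of the statement act on them as expected
    ([mu_exchange], [mu_remove], [mu_rep_of_mults], [hom_dim_mu]).

    On the tableau side, an empty box at the top left is recorded as a letter 0,
    and the letters n + 1 are erased one at a time, each just before its slide;
    this is harmless, as slides never look to the right. During a slide the filling
    is semistandard away from the empty box ([punctured]). A move to the left
    does not change the letters of a row. A move from the box above, in row i,
    brings a letter x from row i to row i + 1, and it is the operation T_i: away
    from the column of the empty box, columns are strict, so F_i(s) <= 1 for all
    s; the rule of the slide makes x the last s where the value 1 is reached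
    ([s_max_spells]). Erasing a letter n + 1 is sh_j.

    Each slide must end in the first row, next to the previous zeros. It does,
    because the path of a slide stays strictly to the right of the path of the
    previous one ([barrier]). The result of the slides is therefore
    semistandard once all letters are raised by 1, and its letter counts are
    the multiplicities of pr(M).

    Finally, the inequalities that define B^h(lambda) say exactly that these
    multiplicities are the letter counts of a semistandard rectangular tableau
    ([Bh_tail], [phi_ssyt], [matches_phi]), and such a tableau is determined by
    its letter counts ([phi_unique]), since rows increase. *)

Set Implicit Arguments.
Unset Strict Implicit.
Unset Printing Implicit Defensive.

Import Order.TTheory GRing.Theory Num.Theory.

(** * Direct sums and direct summands of representations *)

Section LinearFacts.
Local Open Scope ring_scope.
Variable K : fieldType.

(** [lfunE] for a function that is not declared linear. *)
Lemma linfun_linear (U V : vectType K) (f : U -> V) :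
  linear f -> linfun f =1 f.
Proof.
move=> lf x.
pose g : {linear U -> V} := HB.pack f (GRing.isLinear.Build K U V *:%R f lf).
exact: (lfunE g x).
Qed.

Lemma dim_prod_subspace (U V : vectType K) (W : {vspace (U * V)%type})
    (A : {vspace U}) (B : {vspace V}) :
  (forall x, (x \in W) = (x.1 \in A) && (x.2 \in B)) ->
  \dim W = (\dim A + \dim B)%N.
Proof.
move=> WAB.
have lfst : linear (@fst U V) by move=> a [? ?] [? ?].
have lsnd : linear (@snd U V) by move=> a [? ?] [? ?].
have fstE := linfun_linear lfst; have sndE := linfun_linear lsnd.
rewrite -(limg_ker_dim (linfun fst) W) addnC; congr (_ + _)%N.
  have -> : (linfun fst @: W = A)%VS; last by [].
  apply/vspaceP => x; apply/memv_imgP/idP => [[y yW ->]|xA].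
    by rewrite fstE; move: yW; rewrite WAB => /andP[].
  by exists (x, 0); rewrite ?fstE // WAB xA mem0v.
have <- : (linfun snd @: (W :&: lker (linfun fst)) = B)%VS.
  apply/vspaceP => x; apply/memv_imgP/idP => [[y yW ->]|xB].
    by move: yW; rewrite memv_cap WAB sndE => /andP[/andP[]].
  exists (0, x); last by rewrite sndE.
  by rewrite memv_cap memv_ker fstE WAB xB mem0v /= eqxx.
rewrite limg_dim_eq //; apply/eqP; rewrite -subv0; apply/subvP => -[x y].
rewrite !memv_cap !memv_ker fstE sndE /= => /andP[/andP[_ /eqP->] /eqP->].
exact: mem0v.
Qed.

End LinearFacts.

Section DirectSums.
Local Open Scope ring_scope.
Variables (K : fieldType) (Q : quiver).
Implicit Types M N X : rep K Q.

Lemma rep_map_dsum M N a x :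
  rep_map (dsum M N) a x = (rep_map M a x.1, rep_map N a x.2).
Proof.
rewrite [LHS]linfun_linear // => c y z; apply/pair_equal_spec.
by split; rewrite /= linearP.
Qed.

Lemma rep_iso_intro M N (f : forall v, M v -> N v) :
    (forall v, linear (f v)) ->
    (forall a x, f (tgt a) (rep_map M a x) = rep_map N a (f (src a) x)) ->
    (forall v, bijective (f v)) ->
  rep_iso M N.
Proof.
move=> lf fM fb; exists (fun v => linfun (f v)); split=> [a|v].
  by apply/lfunP => x; rewrite !comp_lfunE !(linfun_linear (lf _)) fM.
by apply: (eq_bij (fb v)) => x; rewrite (linfun_linear (lf _)).
Qed.

Lemma rep_iso_trans N M X : rep_iso M N -> rep_iso N X -> rep_iso M X.
Proof.
move=> [f [fM fb]] [g [gM gb]]; exists (fun v => (g v \o f v)%VF); split.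
  by move=> a; rewrite comp_lfunA -gM -!comp_lfunA fM.
move=> v; apply: (eq_bij (bij_comp (gb v) (fb v))) => x /=.
by rewrite comp_lfunE.
Qed.

Lemma rep_iso_dsuml M N X : rep_iso M N -> rep_iso (dsum M X) (dsum N X).
Proof.
move=> [f [fM fb]].
apply: (@rep_iso_intro (dsum M X) (dsum N X)
  (fun v (x : M v * X v) => (f v x.1, x.2))).
- by move=> v c [? ?] [? ?] /=; rewrite linearP.
- move=> a x; rewrite !rep_map_dsum /=; congr (_, _).
  by have /lfunP/(_ x.1) := fM a; rewrite !comp_lfunE.
move=> v; have [g gf fg] := fb v.
by exists (fun x : N v * X v => (g x.1, x.2)) => -[x y] /=; rewrite ?gf ?fg.
Qed.

Lemma rep_iso_dsumr0 M : rep_iso M (dsum M (rep0 K Q)).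
Proof.
apply: (@rep_iso_intro M (dsum M (rep0 K Q)) (fun v x => (x, 0))).
- by move=> v c x y /=; apply/pair_equal_spec; split=> //; rewrite [RHS]thinmx0.
- by move=> a x; rewrite rep_map_dsum /= linear0.
move=> v; exists (fun x : M v * 'rV_0 => x.1) => // -[x y] /=.
by apply/pair_equal_spec; split; last by rewrite [y]thinmx0.
Qed.

Lemma rep_iso_dsumA M N X : rep_iso (dsum (dsum M N) X) (dsum M (dsum X N)).
Proof.
apply: (@rep_iso_intro (dsum (dsum M N) X) (dsum M (dsum X N))
  (fun v (x : M v * N v * X v) => (x.1.1, (x.2, x.1.2)))).
- by move=> v c [[? ?] ?] [[? ?] ?].
- by move=> a x; rewrite !rep_map_dsum.
move=> v; exists (fun x : M v * (X v * N v) => ((x.1, x.2.2), x.2.1)).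
  by move=> [[? ?] ?].
by move=> [? [? ?]].
Qed.

Lemma summand_rep_powS X N k N' :
  rep_iso N (dsum N' X) -> summand (rep_pow X k) N' ->
  summand (rep_pow X k.+1) N.
Proof.
move=> isoN [P isoN']; exists P.
apply: rep_iso_trans isoN _.
apply: rep_iso_trans (rep_iso_dsuml X isoN') _.
exact: rep_iso_dsumA.
Qed.

(** A split monomorphism: the complement is the kernel of the retraction. *)
Lemma summand_of_retract X N (sec : forall v, 'Hom(X v, N v))
    (ret : forall v, 'Hom(N v, X v)) :
  is_hom sec -> is_hom ret -> (forall v x, ret v (sec v x) = x) ->
  summand X N.
Proof.
move=> secM retM secK.
have secE a x : sec (tgt a) (rep_map X a x) = rep_map N a (sec (src a) x).
  by have /lfunP/(_ x) := secM a; rewrite !comp_lfunE.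
have retE a x : ret (tgt a) (rep_map N a x) = rep_map X a (ret (src a) x).
  by have /lfunP/(_ x) := retM a; rewrite !comp_lfunE.
pose P := @Rep K Q (fun v => subvs_of (lker (ret v)))
  (fun a => linfun (fun u : subvs_of (lker (ret (src a))) =>
     vsproj (lker (ret (tgt a))) (rep_map N a (vsval u)))).
have mapP a u : vsval (rep_map P a u) = rep_map N a (vsval u).
  rewrite [rep_map P a u]linfun_linear; last first.
    by move=> c x y; rewrite !linearP.
  by rewrite vsprojK // memv_ker retE; move: (subvsP u);
     rewrite memv_ker => /eqP->; rewrite linear0.
have kerP v x : x - sec v (ret v x) \in lker (ret v).
  by rewrite memv_ker linearB /= secK subrr.
exists P; apply: (@rep_iso_intro N (dsum P X)
  (fun v x => (vsproj (lker (ret v)) (x - sec v (ret v x)), ret v x))).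
- move=> v c x y /=; apply/pair_equal_spec; split; last by rewrite linearP.
  have -> : c *: x + y - sec v (ret v (c *: x + y)) =
      c *: (x - sec v (ret v x)) + (y - sec v (ret v y)).
    by rewrite (linearP (ret v)) (linearP (sec v)) opprD scalerBr addrACA.
  by rewrite linearP.
- move=> a x; rewrite rep_map_dsum; apply/pair_equal_spec; split; last first.
    exact: retE.
  apply: val_inj; rewrite /= [RHS]mapP.
  rewrite (vsprojK (kerP _ _)) (vsprojK (kerP _ _)).
  by rewrite retE linearB /= secE.
move=> v; exists (fun x : subvs_of (lker (ret v)) * X v =>
  vsval x.1 + sec v x.2).
  by move=> x /=; rewrite (vsprojK (kerP _ _)) addrNK.
move=> [u x] /=; have := subvsP u; rewrite memv_ker => /eqP u0.
have retD : ret v (vsval u + sec v x) = x.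
  by rewrite (linearD (ret v)) /= u0 secK add0r.
by rewrite retD addrK vsvalK.
Qed.

End DirectSums.

(** * The rank formula for multiplicities in type A *)

Section Vertices.
Variable n : nat.
Implicit Types (v w : 'I_n) (a : arrow (quiverA n)).

Definition arrow_into w (h : (w.+1 < n)%N) : arrow (quiverA n) :=
  exist _ (Ordinal h, w) (eqxx w.+1).

Lemma src_tgt a : (src a : 'I_n) = (tgt a : 'I_n).+1 :> nat.
Proof. by case: a => -[x y] /= /eqP. Qed.

Lemma tgt_inj a a' : (tgt a : 'I_n) = tgt a' :> nat -> a = a'.
Proof.
move=> e; apply: val_inj; move: (src_tgt a) (src_tgt a'); move: e.
case: a a' => [[x y] ?] [[x' y'] ?] /= e ex ex'.
by congr (_, _); apply: val_inj => //=; rewrite ex ex' e.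
Qed.

Lemma src_inj a a' : (src a : 'I_n) = src a' :> nat -> a = a'.
Proof. by rewrite !src_tgt => -[/tgt_inj]. Qed.

Lemma arrow_into_or_top w : (exists a, tgt a = w) \/ w.+1 = n.
Proof.
case: (ltnP w.+1 n) => [h|h]; first by left; exists (arrow_into h).
by right; apply/eqP; rewrite eqn_leq h ltn_ord.
Qed.

Lemma arrow_from_or_bottom w : (exists a, src a = w) \/ w = 0%N :> nat.
Proof.
case: w => -[|k] h; [by right | left].
exists (@arrow_into (Ordinal (ltnW h)) h); exact: val_inj.
Qed.

End Vertices.

Section Invariants.
Local Open Scope ring_scope.
Variables (K : fieldType) (n : nat).
Implicit Types (M N : rep K (quiverA n)) (v w : 'I_n) (a : arrow (quiverA n)).

(** The image in [M w] of the path of length [d] ending at [w], and zero if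
    there is no such path. At most one arrow ends at [w]; the sum over all arrows
    singles it out without a case distinction on [w], and the [eq_rect]
    only bridges [tgt a] and [w]. *)
Fixpoint path_im M (d : nat) (w : 'I_n) : {vspace M w} :=
  if d is d'.+1 then
    (\sum_(a : arrow (quiverA n))
      match @eqP _ (tgt a : 'I_n) w with
      | ReflectT e => eq_rect _ (fun x : 'I_n => {vspace M x})
                        (rep_map M a @: path_im M d' (src a)) w e
      | ReflectF _ => 0
      end)%VS
  else fullv.

(** The kernel of the arrow that starts at [w], in the same encoding; the whole
    space at the bottom vertex. *)
Definition out_ker M w : {vspace M w} :=
  (\bigcap_(a : arrow (quiverA n))
    match @eqP _ (src a : 'I_n) w with
    | ReflectT e => eq_rect _ (fun x : 'I_n => {vspace M x})
                      (lker (rep_map M a)) w e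
    | ReflectF _ => fullv
    end)%VS.

Lemma path_im_succ M d w : path_im M d.+1 w =
  (\sum_(a : arrow (quiverA n))
    match @eqP _ (tgt a : 'I_n) w with
    | ReflectT e => eq_rect _ (fun x : 'I_n => {vspace M x})
                      (rep_map M a @: path_im M d (src a)) w e
    | ReflectF _ => 0
    end)%VS.
Proof. by []. Qed.

Lemma path_im_tgt M d a :
  path_im M d.+1 (tgt a) = (rep_map M a @: path_im M d (src a))%VS.
Proof.
rewrite path_im_succ (bigD1 a) // big1 => [|b /andP[_ ba]].
  by case: eqP => [e|[]//]; rewrite (eq_axiomK e) [LHS]addv0.
by case: eqP => // e; case/eqP: ba; exact: tgt_inj (congr1 val e).
Qed.

Lemma path_im_top M d w : w.+1 = n -> path_im M d.+1 w = 0%VS.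
Proof.
move=> wn; rewrite path_im_succ big1 // => a _; case: eqP => // e.
exfalso; have := ltn_ord (src a : 'I_n).
by rewrite src_tgt (congr1 (fun x : 'I_n => x.+1) e) wn ltnn.
Qed.

Lemma out_ker_src M a : out_ker M (src a) = lker (rep_map M a).
Proof.
rewrite /out_ker (bigD1 a) // big1 => [|b /andP[_ ba]].
  by case: eqP => [e|[]//]; rewrite (eq_axiomK e) [LHS]capvf.
by case: eqP => // e; case/eqP: ba; exact: src_inj (congr1 val e).
Qed.

Lemma out_ker_bottom M w : w = 0%N :> nat -> out_ker M w = fullv.
Proof.
move=> w0; rewrite /out_ker big1 // => a _; case: eqP => // e.
exfalso; have := src_tgt a.
by rewrite (congr1 (fun x : 'I_n => x : nat) e) w0.
Qed.

Lemma path_imS M d w : (path_im M d.+1 w <= path_im M d w)%VS.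
Proof.
elim: d w => [|d IHd] w; first exact: subvf.
case: (arrow_into_or_top w) => [[a <-]|/path_im_top->]; last exact: sub0v.
by rewrite !path_im_tgt limgS.
Qed.

(** In terms of a decomposition, this is the number of summands M(r,s) of [M]
    with [r = w + 1] and [w + d < s], that is, those whose support ends at [w]
    and contains the top of the path. *)
Definition socle_dim M (w : 'I_n) d := \dim (out_ker M w :&: path_im M d w).

(** The multiplicity of M(w+1,w+d+1), see [mult_rank_mu]. *)
Definition rank_mu M (w : 'I_n) d := (socle_dim M w d - socle_dim M w d.+1)%N.

Lemma socle_dimS M w d : (socle_dim M w d.+1 <= socle_dim M w d)%N.
Proof. by apply/dimvS/capvS => //; apply: path_imS. Qed.

Lemma rank_muK M w d : (socle_dim M w d.+1 + rank_mu M w d)%N = socle_dim M w d.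
Proof. exact/subnKC/socle_dimS. Qed.

Section IsoInvariance.
Variables (M N : rep K (quiverA n))
  (f : forall v : vertex (quiverA n), 'Hom(M v, N v)).
Hypotheses (fM : is_hom f) (fb : forall v, bijective (f v)).

Let fE a x : f (tgt a) (rep_map M a x) = rep_map N a (f (src a) x).
Proof. by have /lfunP/(_ x) := fM a; rewrite !comp_lfunE. Qed.

Lemma out_ker_iso w x : (f w x \in out_ker N w) = (x \in out_ker M w).
Proof.
case: (arrow_from_or_bottom w) => [[a aw]|w0]; last first.
  by rewrite !out_ker_bottom // !memvf.
subst w; rewrite !out_ker_src !memv_ker -fE -(inj_eq (bij_inj (fb _))).
by rewrite linear0.
Qed.

Lemma path_im_iso d w : path_im N d w = (f w @: path_im M d w)%VS.
Proof.
elim: d w => [|d IHd] w.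
  apply/vspaceP => x; rewrite memvf; apply/esym/memv_imgP.
  by have [g _ fg] := fb w; exists (g x); rewrite ?fg ?memvf.
case: (arrow_into_or_top w) => [[a aw]|wn]; last first.
  by rewrite !path_im_top // limg0.
by subst w; rewrite !path_im_tgt IHd -!limg_comp fM.
Qed.

Lemma socle_dim_hom w d : socle_dim M w d = socle_dim N w d.
Proof.
have kf : lker (f w) == 0%VS by apply/lker0P/bij_inj/fb.
have -> : socle_dim N w d = \dim (f w @: (out_ker M w :&: path_im M d w)).
  congr (\dim _); rewrite (lker0_img_cap _ _ kf) -path_im_iso.
  congr (_ :&: _)%VS; apply/vspaceP => x; apply/idP/memv_imgP => [xK|[y]].
    have [g gf fg] := fb w; exists (g x); rewrite ?fg //.
    by rewrite -out_ker_iso fg.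
  by move=> yK ->; rewrite out_ker_iso.
by rewrite limg_dim_eq // (eqP kf) capv0.
Qed.

End IsoInvariance.

Lemma socle_dim_iso M N w d : rep_iso M N -> socle_dim M w d = socle_dim N w d.
Proof. by case=> f [fM fb]; apply: socle_dim_hom fM fb w d. Qed.

Lemma mem_path_im_dsum M N d w x :
  (x \in path_im (dsum M N) d w) =
  (x.1 \in path_im M d w) && (x.2 \in path_im N d w).
Proof.
elim: d w x => [|d IHd] w x; first by rewrite !memvf.
case: (arrow_into_or_top w) => [[a aw]|wn]; last first.
  by rewrite !path_im_top // !memv0; case: x.
subst w; rewrite !path_im_tgt; apply/memv_imgP/andP => [[y yI ->]|[]].
  move: yI; rewrite rep_map_dsum IHd => /andP[y1 y2].
  by split; apply: memv_img.
move=> /memv_imgP[y yI ey] /memv_imgP[z zI ez]; exists (y, z).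
  by rewrite IHd yI.
by rewrite rep_map_dsum -ey -ez; case: x {ey ez}.
Qed.

Lemma mem_out_ker_dsum M N w x :
  (x \in out_ker (dsum M N) w) = (x.1 \in out_ker M w) && (x.2 \in out_ker N w).
Proof.
case: (arrow_from_or_bottom w) => [[a aw]|w0]; last first.
  by rewrite !out_ker_bottom // !memvf.
by subst w; rewrite !out_ker_src !memv_ker rep_map_dsum.
Qed.

Lemma socle_dim_dsum M N w d :
  socle_dim (dsum M N) w d = (socle_dim M w d + socle_dim N w d)%N.
Proof.
apply: dim_prod_subspace => x.
by rewrite !memv_cap mem_path_im_dsum mem_out_ker_dsum andbACA.
Qed.

Lemma socle_dim0 w d : socle_dim (rep0 K (quiverA n)) w d = 0%N.
Proof.
apply/eqP; rewrite -leqn0; apply: leq_trans (dimvS (subvf _)) _.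
by rewrite dimvf /dim /= muln0.
Qed.

Lemma rank_mu_iso M N w d : rep_iso M N -> rank_mu M w d = rank_mu N w d.
Proof. by move=> MN; rewrite /rank_mu !(socle_dim_iso _ _ MN). Qed.

Lemma rank_mu_dsum M N w d : rank_mu (dsum M N) w d = (rank_mu M w d + rank_mu N w d)%N.
Proof.
apply: (@addnI (socle_dim (dsum M N) w d.+1)).
by rewrite rank_muK !socle_dim_dsum addnACA !rank_muK.
Qed.

Lemma rank_mu0 w d : rank_mu (rep0 K (quiverA n)) w d = 0%N.
Proof. by rewrite /rank_mu !socle_dim0. Qed.

Lemma rank_mu_rep_pow M k w d : rank_mu (rep_pow M k) w d = (k * rank_mu M w d)%N.
Proof. by elim: k => [|k IHk]; rewrite ?rank_mu0 // rank_mu_dsum IHk. Qed.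

(** The sum telescopes, as the image of a long enough path is zero. *)
Lemma sum_rank_mu M (w : 'I_n) :
  (\sum_(0 <= d < n - w) rank_mu M w d)%N = \dim (out_ker M w).
Proof.
have im0 d (v : 'I_n) : (n <= v + d)%N -> path_im M d v = 0%VS.
  elim: d v => [|d IHd] v; first by rewrite addn0 leqNgt ltn_ord.
  case: (arrow_into_or_top v) => [[a <-]|/path_im_top->] // le.
  by rewrite path_im_tgt IHd ?limg0 // src_tgt addSnnS.
have -> : \dim (out_ker M w) =
    (socle_dim M w (n - w) + \sum_(0 <= d < n - w) rank_mu M w d)%N; last first.
  rewrite /socle_dim im0 ?capv0 ?dimv0 //.
  by rewrite subnKC // ltnW.
elim: (n - w)%N => [|k IHk]; first by rewrite big_geq // addn0 /socle_dim capvf.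
by rewrite IHk big_nat_recr //= [in RHS]addnC -addnA [(rank_mu _ _ _ + _)%N]addnC
   rank_muK addnC.
Qed.

Lemma rep_map_Mrs r s a u : rep_map (Mrs K n r s) a u = u *m const_mx 1.
Proof. by rewrite [LHS]lfunE. Qed.

Lemma dim_rV k : \dim {: 'rV[K]_k} = k.
Proof. by rewrite dimvf /dim /= mul1n. Qed.

(** The arrows of M(r,s) are bijective inside its support; the spaces
    there have dimension [true] = 1. *)
Lemma const_mx_bool (b b' : bool) (x : 'rV[K]_b) (y : 'rV[K]_b') : b -> b' ->
  (exists x : 'rV[K]_b, x *m const_mx 1 = y) /\
  (x *m (const_mx 1 : 'M_(b, b')) = 0 -> x = 0).
Proof.
case: b x => // x; case: b' y => // y _ _.
have -> : const_mx 1 = 1%:M :> 'M[K]_1.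
  by apply/matrixP => i j; rewrite !mxE !ord1.
by split; [exists y |]; rewrite mulmx1.
Qed.

Lemma Mrs_off_support r s w (U V : {vspace Mrs K n r s w}) :
  (r <= w.+1 <= s)%N = false -> U = V.
Proof.
move=> off; suff U0 (W : {vspace Mrs K n r s w}) : W = 0%VS by rewrite (U0 U) (U0 V).
apply/eqP; rewrite -dimv_eq0 -leqn0; apply: leq_trans (dimvS (subvf _)) _.
by rewrite dim_rV off.
Qed.

Lemma path_im_Mrs r s d w : (s <= n)%N ->
  path_im (Mrs K n r s) d w =
  if (r <= w.+1)%N && (w + d < s)%N then fullv else 0%VS.
Proof.
move=> sn; elim: d w => [|d IHd] w.
  rewrite addn0; case: ifP => // off; exact: Mrs_off_support.
case: (arrow_into_or_top w) => [[a aw]|wn]; last first.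
  rewrite path_im_top //; case: ifP => // /andP[_ lt].
  by have := leq_trans lt sn; rewrite addnS -addSn wn ltnNge leq_addr.
subst w; case: (boolP (r <= (tgt a : 'I_n).+1 <= s)%N) => [on|/negbTE off];
  last exact: Mrs_off_support.
rewrite path_im_tgt IHd src_tgt addSnnS.
have /andP[r_le le_s] := on; rewrite r_le (leqW r_le) /=.
case: ifP => lt_s; last exact: limg0.
apply/vspaceP => y; rewrite memvf; apply/memv_imgP.
have on' : (r <= (src a : 'I_n).+1 <= s)%N.
  rewrite src_tgt leqW //=; apply: leq_trans lt_s.
  by rewrite addnS !ltnS leq_addr.
have [[x <-] _] := const_mx_bool 0 y on' on.
by exists x; rewrite ?memvf ?rep_map_Mrs.
Qed.

Lemma out_ker_Mrs r s w : (0 < r)%N -> (r <= w.+1 <= s)%N ->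
  out_ker (Mrs K n r s) w = if w.+1 == r then fullv else 0%VS.
Proof.
move=> r0 on; case: (arrow_from_or_bottom w) => [[a aw]|w0]; last first.
  rewrite out_ker_bottom //; case: eqP => // wr.
  by move: on wr; rewrite w0; case: r r0 => [|[]].
subst w; rewrite out_ker_src; case: eqP => [wr|/eqP wr].
  apply/vspaceP => x; rewrite memvf memv_ker.
  have off : (r <= (tgt a : 'I_n).+1 <= s)%N = false.
    by rewrite -wr src_tgt ltnn.
  have: rep_map (Mrs K n r s) a x \in (0%VS : {vspace Mrs K n r s (tgt a)}).
    by rewrite (Mrs_off_support 0%VS fullv off) memvf.
  by rewrite memv0.
apply/vspaceP => x; rewrite memv_ker memv0 rep_map_Mrs; apply/eqP/eqP => [x0|->].
  have on' : (r <= (tgt a : 'I_n).+1 <= s)%N.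
    case/andP: on => ra sa; rewrite -src_tgt (ltnW sa) andbT -ltnS.
    by rewrite ltn_neqAle eq_sym wr.
  by have [_ /(_ x0)] := const_mx_bool x 0 on on'.
exact: mul0mx.
Qed.

Lemma socle_dim_Mrs r s w d : (0 < r)%N -> (s <= n)%N ->
  socle_dim (Mrs K n r s) w d = ((w.+1 == r) && (w + d < s)%N).
Proof.
move=> r0 sn; case: (boolP (r <= w.+1 <= s)%N) => [on|/negbTE off].
  rewrite /socle_dim out_ker_Mrs // path_im_Mrs //; case/andP: on => r_le le_s.
  rewrite r_le /=; case: ifP => _; last by rewrite cap0v dimv0.
  case: ifP => _; last by rewrite capv0 dimv0.
  by rewrite capvf dim_rV r_le le_s.
rewrite /socle_dim (Mrs_off_support (_ :&: _)%VS 0%VS off) dimv0.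
case: eqP => //= wr; case: ltnP => // lt; case/negP: (negbT off).
by rewrite wr leqnn -wr; apply: leq_trans lt; rewrite ltnS leq_addr.
Qed.

Lemma rank_mu_Mrs r s w d : (0 < r)%N -> (s <= n)%N ->
  rank_mu (Mrs K n r s) w d = ((w.+1 == r) && ((w + d).+1 == s)).
Proof.
move=> r0 sn; rewrite /rank_mu !socle_dim_Mrs // addnS.
case: (w.+1 == r) => //=; rewrite [in LHS]leq_eqVlt.
by case: eqP => [->|_] /=; [rewrite ltnn | case: ltnP].
Qed.

(** The images of a preimage of [y] along the path; when the arrow leaving [w]
    kills [y], they are the images of the basis vectors under a morphism from
    M(w+1,w+d+1). *)
Lemma path_im_lift M d w y : y \in path_im M d w ->
  exists2 x : forall v, M v, x w = y &
    forall a, (w <= (tgt a : 'I_n))%N -> ((src a : 'I_n) <= w + d)%N ->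
      rep_map M a (x (src a)) = x (tgt a).
Proof.
elim: d w y => [|d IHd] w y.
  exists (dfwith (fun v => 0 : M v) y); first exact: dfwith_in.
  by move=> a wa; rewrite src_tgt addn0 ltnNge wa.
case: (arrow_into_or_top w) => [[b bw]|wn]; last first.
  rewrite path_im_top // memv0 => /eqP->; exists (fun v => 0) => // a.
  by rewrite linear0.
subst w; rewrite path_im_tgt => /memv_imgP[z /IHd[x xz xE] ->].
exists (dfwith x (rep_map M b z)) => [|a]; first exact: dfwith_in.
rewrite leq_eqVlt => /orP[/eqP/tgt_inj <-|lt] le.
  rewrite dfwith_in dfwith_out ?xz // -val_eqE /= src_tgt.
  by rewrite neq_ltn ltnSn.
rewrite !dfwith_out; first by apply: xE; [rewrite src_tgt | rewrite (src_tgt b) addSnnS].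
  by apply: contraTneq lt => ->; rewrite ltnn.
by apply: contraTneq lt => e; rewrite e src_tgt ltnNge leqW.
Qed.

(** Composing a linear form on [M w] with the paths into [w] gives the components
    of a morphism to M(w+1,w+d+1), provided that the form kills
    [path_im M d.+1 w]. *)
Lemma form_pullback M (U : vectType K) w (f : 'Hom(M w, U)) :
  exists2 g : forall v, 'Hom(M v, U), g w = f &
    forall a, (w <= (tgt a : 'I_n))%N ->
      g (src a) = (g (tgt a) \o rep_map M a)%VF.
Proof.
suff: forall k, exists2 g : forall v, 'Hom(M v, U), g w = f &
    forall a, (w <= (tgt a : 'I_n) < k)%N ->
      g (src a) = (g (tgt a) \o rep_map M a)%VF.
  case/(_ n) => g gw gE; exists g => // a wa.
  by apply: gE; rewrite wa ltn_ord.
elim=> [|k [g gw gE]].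
  exists (dfwith (fun v => 0 : 'Hom(M v, U)) f); first exact: dfwith_in.
  by move=> a; rewrite andbF.
case: (pselect (exists b : arrow (quiverA n), (tgt b : 'I_n) = k :> nat))
  => [[b bk]|no]; last first.
  exists g => // a /andP[wa]; rewrite ltnS leq_eqVlt => /orP[/eqP ak|lt].
    by case: no; exists a.
  by apply: gE; rewrite wa.
case: (leqP w k) => [wk|kw]; last first.
  exists g => // a /andP[wa]; rewrite ltnS => ak.
  by have := leq_trans (leq_ltn_trans ak kw) wa; rewrite ltnn.
exists (dfwith g (g (tgt b) \o rep_map M b)%VF).
  rewrite dfwith_out //; apply: contraTneq wk => <-.
  by rewrite src_tgt bk ltnn.
move=> a /andP[wa ak].
have ba : src b != tgt a.
  by apply: contraTneq ak => <-; rewrite src_tgt bk ltnn.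
rewrite (dfwith_out _ _ ba); move: ak; rewrite ltnS leq_eqVlt.
case/orP => [/eqP ak|lt].
  have -> : a = b by apply: tgt_inj; rewrite ak bk.
  exact: dfwith_in.
rewrite dfwith_out ?gE ?wa //; apply: contraTneq lt => /(congr1 val) /= e.
by move/eqP: e; rewrite !src_tgt eqSS bk => /eqP->; rewrite ltnn.
Qed.

End Invariants.

Section Multiplicities.
Local Open Scope ring_scope.
Variables (K : fieldType) (n : nat).
Implicit Types (M N : rep K (quiverA n)) (v w : 'I_n) (a : arrow (quiverA n)).

Lemma separating_form (V : vectType K) (U : {vspace V}) y : y \notin U ->
  exists2 f : 'Hom(V, K^o), f y = 1 & (U <= lker f)%VS.
Proof.
move=> yU; pose z := y - projv U y.
have z0 : z != 0.
  by apply: contraNneq yU => /subr0_eq ->; rewrite memv_proj.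
have lf : linear (fun x => coord [tuple z] ord0 (x - projv U x) : K^o).
  move=> c u x; rewrite (linearP (projv U)) opprD addrACA -scalerBr.
  by rewrite linearP.
exists (linfun (fun x => coord [tuple z] ord0 (x - projv U x) : K^o)).
  rewrite (linfun_linear lf); have fz : free [tuple z] by rewrite seq1_free.
  exact: (coord_free ord0 ord0 fz).
apply/subvP => u uU; rewrite memv_ker (linfun_linear lf) projv_id // subrr.
by rewrite linear0.
Qed.

(** A vector [y] of the kernel that is an image from [w + d] but not from
    [w + d + 1] gives a copy of M(w+1,w+d+1); a linear form that takes the value 1
    at [y] and kills the image from [w + d + 1] gives a retraction onto it. *)
Lemma summand_Mrs N w d : (0 < rank_mu N w d)%N ->
  summand (Mrs K n w.+1 (w + d).+1) N.
Proof.
rewrite subn_gt0 => lt_dim.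
have /subvPn[y] : ~~ (out_ker N w :&: path_im N d w
                       <= out_ker N w :&: path_im N d.+1 w)%VS.
  by apply: contraL lt_dim => /dimvS; rewrite -leqNgt.
rewrite !memv_cap => /andP[yK yI]; rewrite yK andTb => yI1.
have [x xw xE] := path_im_lift yI.
have [f fy fI] := separating_form yI1.
have [g gw gE] := form_pullback f.
(* the retraction is the identity on the copy *)
have gx k v : (v = w + k :> nat)%N -> (k <= d)%N -> g v (x v) = 1.
  elim: k v => [|k IHk] v vE kd.
    have -> : v = w by apply: val_inj; rewrite /= vE addn0.
    by rewrite gw xw.
  case: (arrow_from_or_bottom v) => [[a av]|v0]; last first.
    by rewrite v0 addnS in vE.
  subst v; have aE : (tgt a : 'I_n) = (w + k)%N :> nat.
    by move: vE; rewrite src_tgt addnS => -[].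
  rewrite gE ?comp_lfunE ?aE ?leq_addr // xE ?aE ?leq_addr //.
    by apply: IHk => //; apply: ltnW.
  by rewrite vE leq_add2l.
(* the pulled-back form kills the image of the arrow entering the top vertex *)
have gI k v : (v = w + k :> nat)%N -> (k <= d)%N ->
    (path_im N (d - k).+1 v <= lker (g v))%VS.
  elim: k v => [|k IHk] v vE kd.
    have -> : v = w by apply: val_inj; rewrite /= vE addn0.
    by rewrite gw subn0.
  case: (arrow_from_or_bottom v) => [[a av]|v0]; last first.
    by rewrite v0 addnS in vE.
  subst v; have aE : (tgt a : 'I_n) = (w + k)%N :> nat.
    by move: vE; rewrite src_tgt addnS => -[].
  have := IHk _ aE (ltnW kd); rewrite path_im_tgt subnSK // => /subvP sub.
  apply/subvP => z zI; rewrite memv_ker gE ?aE ?leq_addr // comp_lfunE.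
  by have := sub _ (memv_img (rep_map N a) zI); rewrite memv_ker.
pose X := Mrs K n w.+1 (w + d).+1.
(* outside the support the sum is empty and the matrix has no entry, so both
   maps vanish there *)
pose sec (v : 'I_n) (u : X v) : N v := (\sum_i u 0 i) *: x v.
pose ret (v : 'I_n) (z : N v) : X v := const_mx (g v z).
have sec_lin v : linear (@sec v).
  move=> c u u'; rewrite /sec scalerA -scalerDl mulr_sumr -big_split.
  by congr (_ *: _); apply: eq_bigr => i _; rewrite !mxE.
have ret_lin v : linear (@ret v).
  by move=> c u u'; apply/matrixP => i j; rewrite !mxE linearP.
apply: (@summand_of_retract _ _ X N (fun v => linfun (@sec v))
                                    (fun v => linfun (@ret v))).
- move=> a; apply/lfunP => u; rewrite !comp_lfunE.
  rewrite !(linfun_linear (sec_lin _)) rep_map_Mrs linearZ /=.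
  rewrite [X in X *: _ = _](_ : _ =
    (\sum_k u 0 k) *+ (w.+1 <= (tgt a : 'I_n).+1 <= (w + d).+1)%N); last first.
    transitivity (\sum_(i < (w.+1 <= (tgt a : 'I_n).+1 <= (w + d).+1)%N)
        \sum_k u 0 k); last by rewrite sumr_const card_ord.
    apply: eq_bigr => i _; rewrite mxE; apply: eq_bigr => k _.
    by rewrite mxE mulr1.
  case/orP: (orbN (w.+1 <= (src a : 'I_n).+1 <= (w + d).+1)%N) => [on|off].
    case/orP: (orbN (w.+1 <= (tgt a : 'I_n).+1 <= (w + d).+1)%N) => [on'|off'].
      rewrite on' mulr1n xE //; first by case/andP: on'.
      by case/andP: on.
    rewrite (negbTE off') mulr0n scale0r.
    have aw : w = src a.
      apply: val_inj; apply/eqP; rewrite /= eqn_leq.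
      case/andP: on off' => wa ad; rewrite -(src_tgt a) (ltnW ad) andbT -ltnNge.
      by rewrite ltnS => ->; rewrite andbT.
    subst w; move: yK; rewrite out_ker_src memv_ker -xw => /eqP->.
    by rewrite scaler0.
  by rewrite big1 ?mul0rn ?scale0r // => k; case: (negP off); case: k; case: (_ && _).
- move=> a; apply/lfunP => z; rewrite !comp_lfunE.
  rewrite !(linfun_linear (ret_lin _)) rep_map_Mrs.
  apply/matrixP => i j; rewrite !mxE.
  have /andP[wa ad] : (w.+1 <= (tgt a : 'I_n).+1 <= (w + d).+1)%N.
    by move: j; case: (_ && _) => // -[].
  transitivity (g (src a) z *+ (w.+1 <= (src a : 'I_n).+1 <= (w + d).+1)%N);
    last first.
    transitivity (\sum_(i < (w.+1 <= (src a : 'I_n).+1 <= (w + d).+1)%N)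
      g (src a) z); first by rewrite sumr_const card_ord.
    by apply: eq_bigr => k _; rewrite !mxE mulr1.
  rewrite ltnS in wa; rewrite ltnS (src_tgt a) (leqW wa) /= ltnS.
  rewrite gE // comp_lfunE; case: ltnP => // da.
  have aE : (tgt a : 'I_n) = (w + d)%N :> nat by apply/eqP; rewrite eqn_leq da andbT.
  have /subvP := gI _ _ aE (leqnn d); rewrite subnn path_im_tgt => sub.
  have /sub := memv_img (rep_map N a) (memvf z).
  by rewrite memv_ker mulr0n => /eqP.
move=> v u; rewrite (linfun_linear (sec_lin _)) (linfun_linear (ret_lin _)).
apply/matrixP => i j; rewrite mxE linearZ /= ord1.
have /andP[wv vd] : (w.+1 <= v.+1 <= (w + d).+1)%N.
  by move: j; case: (_ && _) => // -[].
rewrite (gx (v - w)%N) ?subnKC ?leq_subLR // [LHS]mulr1.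
rewrite (bigD1 j) // big1 ?[LHS]addr0 // => k; case/negP; apply/eqP/val_inj.
by move: j k; case: (_ && _) => [j k | [] //]; rewrite !ord1.
Qed.

Lemma rank_mu_le_dim N w d : (rank_mu N w d <= \dim {: N w})%N.
Proof.
by apply: leq_trans (leq_subr _ _) _; apply: dimvS; apply: subvf.
Qed.

(** One inequality is additivity and nonnegativity of the rank formula; for the
    other, split off copies one by one. *)
Lemma mult_rank_mu N w d : (w + d < n)%N ->
  mult (Mrs K n w.+1 (w + d).+1) N = rank_mu N w d.
Proof.
move=> wd; set X := Mrs K n _ _.
have rankX : rank_mu X w d = 1%N by rewrite rank_mu_Mrs // !eqxx.
apply/eqP; rewrite eqn_leq; apply/andP; split.
  apply/bigmax_leqP => k /asboolP[P /rank_mu_iso ->].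
  by rewrite rank_mu_dsum rank_mu_rep_pow rankX muln1 leq_addl.
have bound : (rank_mu N w d < (\sum_v \dim {: N v}).+1)%N.
  rewrite ltnS (bigD1 w) //=.
  exact: leq_trans (rank_mu_le_dim _ _ _) (leq_addr _ _).
apply: (@leq_bigmax_cond _ _ _ (Ordinal bound)); apply/asboolP => /=.
suff: forall k P, rank_mu P w d = k -> summand (rep_pow X k) P by apply.
elim=> [|k IHk] P rankP.
  by exists P; apply: rep_iso_dsumr0.
have [P' isoP] : summand X P by apply: summand_Mrs; rewrite rankP.
apply: (summand_rep_powS isoP); apply: IHk; apply/eqP.
by rewrite -eqSS -rankP (rank_mu_iso _ _ isoP) rank_mu_dsum rankX addn1.
Qed.

Lemma mu_rank_mu r s : (0 < r)%N -> (r <= s)%N -> (s <= n)%N ->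
  exists w : 'I_n, exists d, [/\ w.+1 = r, (w + d).+1 = s,
    (w + d < n)%N & forall N, mu N r s = rank_mu N w d].
Proof.
case: r => // r _ rs sn.
have rn : (r < n)%N := leq_trans rs sn.
have sE : (r + (s - r.+1)).+1 = s by rewrite -addSn subnKC.
exists (Ordinal rn), (s - r.+1)%N; split=> //=; first by rewrite sE.
by move=> P; rewrite -(@mult_rank_mu P (Ordinal rn)) /= sE.
Qed.

Section Mu.
Variables (r s : nat).
Hypotheses (r_gt0 : (0 < r)%N) (r_le_s : (r <= s)%N) (s_le_n : (s <= n)%N).

Lemma mu_iso M N : rep_iso M N -> mu M r s = mu N r s.
Proof.
have [w [d [_ _ _ E]]] := mu_rank_mu r_gt0 r_le_s s_le_n.
by move=> MN; rewrite !E; apply: rank_mu_iso.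
Qed.

Lemma mu_dsum M N : mu (dsum M N) r s = (mu M r s + mu N r s)%N.
Proof.
have [w [d [_ _ _ E]]] := mu_rank_mu r_gt0 r_le_s s_le_n.
by rewrite !E rank_mu_dsum.
Qed.

Lemma mu_rep0 : mu (rep0 K (quiverA n)) r s = 0%N.
Proof.
have [w [d [_ _ _ E]]] := mu_rank_mu r_gt0 r_le_s s_le_n.
by rewrite !E rank_mu0.
Qed.

Lemma mu_Mrs r' s' : (0 < r')%N -> (s' <= n)%N ->
  mu (Mrs K n r' s') r s = ((r == r') && (s == s')).
Proof.
move=> r'0 s'n.
have [w [d [<- <- _ E]]] := mu_rank_mu r_gt0 r_le_s s_le_n.
by rewrite !E rank_mu_Mrs.
Qed.

Lemma mu_rep_pow M k : mu (rep_pow M k) r s = (k * mu M r s)%N.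
Proof. by elim: k => [|k IHk]; rewrite ?mu_rep0 //= mu_dsum IHk. Qed.

Lemma mu_rep_of_mults c : mu (rep_of_mults K n c) r s = c r s.
Proof.
have muD := big_morph (fun M => mu M r s) mu_dsum mu_rep0.
rewrite /rep_of_mults muD.
under eq_bigr => r' _ do rewrite muD.
have r_n : (r < n.+1)%N by rewrite ltnS (leq_trans r_le_s).
rewrite (bigD1_seq r) /= ?mem_index_iota ?iota_uniq ?r_gt0 //.
rewrite [X in (_ + X)%N]big1_seq ?addn0 => [|r']; last first.
  rewrite mem_index_iota => /andP[r'r /andP[r'0 _]].
  rewrite big_nat big1 // => s' /andP[_ s'n].
  by rewrite mu_rep_pow mu_Mrs // eq_sym (negbTE r'r) muln0.
rewrite (bigD1_seq s) /= ?mem_index_iota ?iota_uniq ?r_le_s //.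
rewrite [X in (_ + X)%N]big1_seq ?addn0 => [|s']; last first.
  rewrite mem_index_iota => /andP[s's /andP[_ s'n]].
  by rewrite mu_rep_pow mu_Mrs // [s == s']eq_sym (negbTE s's) andbF muln0.
by rewrite mu_rep_pow mu_Mrs // !eqxx muln1.
Qed.

Lemma summand_mu N : (0 < mu N r s)%N -> summand (Mrs K n r s) N.
Proof.
have [w [d [<- <- _ E]]] := mu_rank_mu r_gt0 r_le_s s_le_n.
by rewrite E; apply: summand_Mrs.
Qed.

End Mu.

(** The complement chosen by [exchange] is only known up to isomorphism, but
    additivity determines its multiplicities. *)
Lemma mu_exchange r s r' s' E N :
    (0 < r)%N -> (r <= s)%N -> (s <= n)%N ->
    (0 < r')%N -> (r' <= s')%N -> (s' <= n)%N -> (0 < mu N r s)%N ->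
  mu (exchange (Mrs K n r s) E N) r' s' =
  (mu N r' s' - ((r' == r) && (s' == s)) + mu E r' s')%N.
Proof.
move=> r0 rs sn r'0 r's' s'n NX; rewrite /exchange.
case: pselect => [h|[]]; last exact: summand_mu.
rewrite mu_dsum // /complement; case: cid => /= P isoP.
by rewrite (mu_iso _ _ _ isoP) // mu_dsum // mu_Mrs // addnK.
Qed.

Lemma mu_remove r s r' s' N :
    (0 < r)%N -> (r <= s)%N -> (s <= n)%N ->
    (0 < r')%N -> (r' <= s')%N -> (s' <= n)%N -> (0 < mu N r s)%N ->
  mu (remove (Mrs K n r s) N) r' s' =
  (mu N r' s' - ((r' == r) && (s' == s)))%N.
Proof.
move=> r0 rs sn r'0 r's' s'n NX; rewrite /remove.
case: pselect => [h|[]]; last exact: summand_mu.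
rewrite /complement; case: cid => /= P isoP.
by rewrite (mu_iso _ _ _ isoP) // mu_dsum // mu_Mrs // addnK.
Qed.

Lemma simple_off w v (u : Mrs K n w.+1 w.+1 v) : v != w -> u = 0.
Proof.
move=> vw; have off : (w.+1 <= v.+1 <= w.+1)%N = false.
  by apply: contraNF vw => /andP[le ge]; rewrite -val_eqE eqn_leq; apply/andP.
have : u \in (0%VS : {vspace Mrs K n w.+1 w.+1 v}).
  by rewrite (Mrs_off_support 0%VS fullv off) memvf.
by rewrite memv0 => /eqP.
Qed.

Definition simple_gen w : Mrs K n w.+1 w.+1 w := const_mx 1.

Lemma row_bool (b : bool) (u : 'rV[K]_b) : b ->
  u = (\sum_i u 0 i) *: const_mx 1.
Proof.
case: b u => // u _; apply/matrixP => i j.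
by rewrite !mxE mulr1 big_ord1 !ord1.
Qed.

Lemma simple_on w (u : Mrs K n w.+1 w.+1 w) :
  u = (\sum_i u 0 i) *: simple_gen w.
Proof. by apply: row_bool; rewrite leqnn. Qed.

Lemma sum_simple_gen w : \sum_i simple_gen w 0 i = 1.
Proof.
transitivity (\sum_(i < (w.+1 <= w.+1 <= w.+1)%N) (1 : K)).
  by apply: eq_bigr => i _; rewrite mxE.
by rewrite sumr_const card_ord leqnn.
Qed.

Lemma hom_simple_ker M w
    (f : forall v : vertex (quiverA n), 'Hom(Mrs K n w.+1 w.+1 v, M v)) u :
  is_hom f -> f w u \in out_ker M w.
Proof.
move=> fM; case: (arrow_from_or_bottom w) => [[a aw]|w0]; last first.
  by rewrite out_ker_bottom ?memvf.
subst w; have /lfunP/(_ u) := fM a; rewrite !comp_lfunE.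
rewrite out_ker_src memv_ker => <-.
have -> : rep_map (Mrs K n (src a : 'I_n).+1 (src a : 'I_n).+1) a u = 0.
  by apply: simple_off; rewrite -val_eqE /= src_tgt neq_ltn ltnSn.
by rewrite linear0.
Qed.

Lemma out_ker_extend M w y a : y \in out_ker M w ->
  rep_map M a (dfwith (fun v => 0 : M v) y (src a)) = 0.
Proof.
have [aw|aw] := eqVneq w (src a); last by rewrite dfwith_out // linear0.
by subst w; rewrite dfwith_in out_ker_src memv_ker => /eqP.
Qed.

(** A morphism from the simple module at [w] is given by the image of a
    generator, which may be any vector killed by the arrow leaving [w]. *)
Lemma hom_dim_simple M w : hom_dim (Mrs K n w.+1 w.+1) M = \dim (out_ker M w).
Proof.
set X := Mrs K n _ _; apply/eqP; rewrite eqn_leq; apply/andP; split.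
  apply/bigmax_leqP => d /asboolP[f [fM find]].
  have fker i : f i w (simple_gen w) \in out_ker M w by apply: hom_simple_ker.
  pose Y := [tuple f i w (simple_gen w) | i < d].
  have Yfree : free Y.
    apply/freeP => c Y0; apply: find => v; apply/lfunP => u.
    rewrite zero_lfunE sum_lfunE.
    have [vw|vw] := eqVneq v w; last first.
      by rewrite (simple_off u vw) big1 // => i _; rewrite linear0.
    subst v; rewrite (simple_on u); move: (\sum_i u 0 i) => t.
    transitivity (t *: \sum_(i < d) c i *: Y`_i); last by rewrite Y0 scaler0.
    rewrite scaler_sumr.
    apply: eq_bigr => i _; rewrite scale_lfunE linearZ /= !scalerA mulrC.
    by congr (_ *: _); rewrite -(tnth_nth 0 Y i) tnth_mktuple.
  have <- : \dim <<Y>> = d by rewrite -[RHS](size_tuple Y); apply/eqP.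
  apply/dimvS/span_subvP => y /tnthP[i ->]; rewrite tnth_mktuple; exact: fker.
have bound : (\dim (out_ker M w) < (\sum_v \dim {: X v} * \dim {: M v}).+1)%N.
  rewrite ltnS (bigD1 w) //= dim_rV leqnn mul1n.
  by apply: leq_trans (leq_addr _ _); apply/dimvS/subvf.
apply: (@leq_bigmax_cond _ _ _ (Ordinal bound)); apply/asboolP => /=.
set b := vbasis (out_ker M w).
have bK (i : 'I_(\dim (out_ker M w))) : b`_i \in out_ker M w.
  by apply/vbasis_mem/mem_nth; rewrite size_tuple.
pose x i : forall v, M v := dfwith (fun v => 0 : M v) (b`_i : M w).
pose f i (v : 'I_n) (u : X v) : M v := (\sum_k u 0 k) *: x i v.
have flin i v : linear (@f i v).
  move=> c u u'; rewrite /f scalerA -scalerDl mulr_sumr -big_split.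
  by congr (_ *: _); apply: eq_bigr => k _; rewrite !mxE.
exists (fun i v => linfun (@f i v)); split.
  move=> i a; apply/lfunP => u; rewrite !comp_lfunE.
  rewrite !(linfun_linear (flin _ _)).
  transitivity (0 : M (tgt a)).
    have [tw|tw] := eqVneq w (tgt a); last by rewrite /f /x dfwith_out // scaler0.
    rewrite (simple_off u) ?linear0 /f; last first.
      by rewrite tw -val_eqE /= src_tgt neq_ltn ltnSn orbT.
    by rewrite big1 ?scale0r // => k _; rewrite mxE.
  by rewrite linearZ /= /x out_ker_extend // scaler0.
move=> c c0; have /freeP := basis_free (vbasisP (out_ker M w)); apply.
have /lfunP/(_ (simple_gen w)) := c0 w; rewrite zero_lfunE sum_lfunE => cw.
rewrite -[RHS]cw.
apply: eq_bigr => i _; rewrite scale_lfunE (linfun_linear (flin _ _)) /f.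
by rewrite sum_simple_gen scale1r /x dfwith_in.
Qed.

Lemma hom_dim_mu M i : (0 < i)%N -> (i <= n)%N ->
  hom_dim (Mrs K n i i) M = (\sum_(i <= s < n.+1) mu M i s)%N.
Proof.
case: i => // i _ ilt; rewrite (hom_dim_simple M (Ordinal ilt)) -sum_rank_mu.
rewrite -{1}[i.+1]add0n big_addn subSS.
rewrite [LHS]big_nat [RHS]big_nat; apply: eq_bigr => d /andP[_ dn].
rewrite -mult_rank_mu /= ?addnS ?[(d + _)%N]addnC //.
by rewrite -ltn_subRL.
Qed.

End Multiplicities.

(** * Tableaux with one empty box, and a single slide *)

Section Slides.
Variables (n j m : nat).
Implicit Types (X : nat -> nat -> nat) (Tf : filling) (r c z e q k : nat).

(** Semistandard away from the box (r, c): rows and columns are compared across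
    the empty box. The letter 0 stands for the empty boxes that are already in
    their final place, the first [z] boxes of the first row. The letters [n + 1]
    that are still to be erased occupy the columns from [e] on of the last row.
    When [r = j] the empty box is outside of the rectangle, and the condition
    bears on the whole filling. *)
Record punctured X (r c z e : nat) : Prop := Punctured {
  row_le : forall q k k', q < j -> k < k' < m ->
    (q != r) || (k != c) -> (q != r) || (k' != c) -> X q k <= X q k';
  col_lt : forall q q' k, q < q' < j -> k < m ->
    (q != r) || (k != c) -> (q' != r) || (k != c) -> X q k < X q' k;
  eq_zero : forall q k, q < j -> k < m -> (q != r) || (k != c) ->
    (X q k == 0) = (q == 0) && (k < z);
  eq_top : forall q k, q < j -> k < m -> (q != r) || (k != c) ->
    (X q k == n.+1) = (q.+1 == j) && (e <= k);
  le_top : forall q k, q < j -> k < m -> (q != r) || (k != c) ->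
    X q k <= n.+1 }.

Definition update X r c x : nat -> nat -> nat :=
  fun q k => if (q == r) && (k == c) then x else X q k.

(** One move of a slide: the box (r', c') becomes the empty one. An empty box
    also contains 0, which is never counted among the letters. *)
Definition move_letter X r c (r' c' : nat) :=
  update (update X r c (X r' c')) r' c' 0.

Lemma move_letterE X r c (r' c' : nat) q k : (q != r') || (k != c') ->
  move_letter X r c r' c' q k = if (q == r) && (k == c) then X r' c' else X q k.
Proof. by rewrite /move_letter /update; case: ifP => // /andP[-> ->]. Qed.

Lemma move_letter_out X r c (r' c' : nat) q k : (q != r) || (k != c) ->
  (q != r') || (k != c') -> move_letter X r c r' c' q k = X q k.
Proof. by move=> n1 n2; rewrite move_letterE // ifF //; lia. Qed.

Lemma move_letter_hole X r c (r' c' : nat) : move_letter X r c r' c' r' c' = 0.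
Proof. by rewrite /move_letter /update !eqxx. Qed.

Lemma punctured_move X r c (r' c' : nat) z e :
    punctured X r c z e -> r < j -> c < m -> c < e ->
    (forall k, k < c -> (r != r') || (k != c') -> X r k <= X r' c') ->
    (forall k, c < k < m -> (r != r') || (k != c') -> X r' c' <= X r k) ->
    (forall q, q < r -> (q != r') || (c != c') -> X q c < X r' c') ->
    (forall q, r < q < j -> (q != r') || (c != c') -> X r' c' < X q c) ->
    X r' c' != 0 -> (r == 0) && (c < z) = false -> X r' c' != n.+1 ->
    X r' c' <= n.+1 ->
  punctured (move_letter X r c r' c') r' c' z e.
Proof.
move=> [Hr Hc H0 Ht Hl] rj cm ce left right above below v0 rz vt vl.
split=> [q k k' qj kk' n1 n2|q q' k qq' km n1 n2|q k qj km n1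
       |q k qj km n1|q k qj km n1].
- rewrite !move_letterE //.
  case: ifP => h1; case: ifP => h2 //.
  + have -> : q = r; [lia | apply: right; lia].
  + have -> : q = r; [lia | apply: left; lia].
  + by apply: Hr => //; lia.
- rewrite !move_letterE //.
  case: ifP => h1; case: ifP => h2; first lia.
  + have -> : k = c; [lia | apply: below; lia].
  + have -> : k = c; [lia | apply: above; lia].
  + by apply: Hc => //; lia.
- rewrite move_letterE //; case: ifP => h1; last by apply: H0; lia.
  rewrite (negbTE v0); lia.
- rewrite move_letterE //; case: ifP => h1; last by apply: Ht; lia.
  rewrite (negbTE vt); lia.
- by rewrite move_letterE //; case: ifP => h1 //; apply: Hl; lia.
Qed.

(** Above the new position of the letter, the column is strict because the
    letter is larger than the upper neighbour of the empty box. *)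
Lemma punctured_left X r c z e :
    punctured X r c z e -> r < j -> 0 < c < m -> c < e -> (r == 0) ==> (z < c) ->
    (0 < r -> X r.-1 c < X r c.-1) ->
  punctured (move_letter X r c r c.-1) r c.-1 z e.
Proof.
move=> P rj cm ce rz up; have [Hr Hc H0 Ht Hl] := P.
have [c0 c_m] := andP cm; have c1m : c.-1 < m by lia.
have ne : (r != r) || (c.-1 != c) by lia.
apply: punctured_move => //.
- move=> k kc _; case: (ltnP k c.-1) => kc1; first by apply: Hr => //; lia.
  by have -> : k = c.-1 by lia.
- by move=> k kc nk; apply: Hr => //; lia.
- move=> q qr nq; have r0 : 0 < r := leq_ltn_trans (leq0n q) qr.
  case: (ltnP q r.-1) => qr1.
    by apply: ltn_trans (Hc q r.-1 c _ _ _ _) (up r0) => //; lia.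
  have -> : q = r.-1 by lia.
  exact: up.
- move=> q qr nq.
  by apply: leq_trans (Hc r q c.-1 _ _ _ _) (Hr q c.-1 c _ _ _ _) => //; lia.
- rewrite H0 //; lia.
- by lia.
- rewrite Ht //; lia.
- exact: Hl.
Qed.

(** Left of the new position of the letter, the row is increasing because the
    letter is at least the left neighbour of the empty box. *)
Lemma punctured_up X r c z e :
    punctured X r c z e -> 0 < r < j -> c < m -> c < e -> z <= c ->
    (0 < c -> X r c.-1 <= X r.-1 c) ->
  punctured (move_letter X r c r.-1 c) r.-1 c z e.
Proof.
move=> P rj cm ce zc left; have [Hr Hc H0 Ht Hl] := P.
have [r0 rj'] := andP rj; have r1j : r.-1 < j by lia.
have ne : (r.-1 != r) || (c != c) by lia.
apply: punctured_move => //.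
- move=> k kc nk; apply: leq_trans (left _); last by lia.
  have [->//|kc1] := eqVneq k c.-1; apply: Hr => //; lia.
- move=> k kc nk; apply: leq_trans (ltnW (Hc r.-1 r k _ _ _ _)) => //; try lia.
  by apply: Hr => //; lia.
- by move=> q qr nq; apply: Hc => //; lia.
- by move=> q qr nq; apply: Hc => //; lia.
- rewrite H0 //; lia.
- by lia.
- rewrite Ht //; lia.
- exact: Hl.
Qed.

(** A puncture that has reached the first row, next to the zeros, is one more
    zero. *)
Lemma punctured_end X z e : z < m -> z < e -> 0 < j -> X 0 z = 0 ->
  punctured X 0 z z e -> punctured X j 0 z.+1 e.
Proof.
move=> zm ze j0 X0 [Hr Hc H0 Ht Hl]; split.
- move=> q k k' qj kk' _ _; case: (posnP q) => [->|q0]; last by apply: Hr; lia.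
  move: kk' (H0 0 k) (H0 0 k') (Hr 0 k k').
  have [->|kz] := eqVneq k z; have [->|kz'] := eqVneq k' z => *; lia.
- move=> q q' k qq' km _ _; move: km (H0 q' k) (Hc q q' k).
  case: q qq' => [|q] ?; have [->|kz] := eqVneq k z => *; lia.
- move=> q k qj km _; move: km (H0 q k); case: q qj => [|q] ?; last by lia.
  have [->|kz] := eqVneq k z => *; lia.
- move=> q k qj km _; move: km (Ht q k); case: q qj => [|q] ?; last by lia.
  have [->|kz] := eqVneq k z => *; lia.
- move=> q k qj km _; move: km (Hl q k); case: q qj => [|q] ?; last by lia.
  have [->|kz] := eqVneq k z => *; lia.
Qed.

(** The content of a box in the computation of [pr_tab], where letters have been
    raised by 1 and where both the letters [n + 1] and the zeros are empty
    boxes. *)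
Definition shown x : option nat :=
  if (x == 0) || (x == n.+1) then None else Some x.+1.

Definition agree Tf X := forall r c, r < j -> c < m -> Tf r c = shown (X r c).

Lemma agree_move Tf X r c (r' c' : nat) x : agree Tf X -> r < j -> c < m ->
  r' < j -> c' < m -> Tf r' c' = Some x ->
  agree (set_box (set_box Tf r c (Some x)) r' c' None) (move_letter X r c r' c').
Proof.
move=> TX rj cm rj' cm' Tx q k qj km; rewrite /set_box /move_letter /update.
by case: ifP => // _; case: ifP => _; rewrite -TX.
Qed.

(** The trace left by the previous slide in the rows up to [r]: it left row [q]
    from column [b q - 1], by an upward move. The letter that came down there is
    at most the letter above and one column to the right, so that the next
    empty box, if it gets as far as column [b q], moves up as well. With
    [b q = 0] there is no constraint, which is the situation before the first
    slide. *)
Definition barrier (b : nat -> nat) X r :=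
  forall q, 0 < q <= r -> b q.-1 <= b q /\
    (0 < b q < m -> X q (b q).-1 <= X q.-1 (b q)).

Lemma barrier_mono b X r q k : barrier b X r -> q <= k <= r -> b q <= b k.
Proof.
move=> B; elim: k => [|k IHk] qk; first by have -> : q = 0 by lia.
case: (ltngtP q k.+1) => [qk1|?|->] //; last by lia.
by have [|/= bk _] := B k.+1; lia.
Qed.

Definition boxes (T : 'M[nat]_(j, m)) : nat -> nat -> nat :=
  fun r c => match insub r : option 'I_j, insub c : option 'I_m with
             | Some r', Some c' => T r' c'
             | _, _ => 0
             end.

Lemma boxesE (T : 'M[nat]_(j, m)) (r : 'I_j) (c : 'I_m) : boxes T r c = T r c.
Proof. by rewrite /boxes !valK. Qed.

Lemma boxes_lt (T : 'M[nat]_(j, m)) r c (rj : r < j) (cm : c < m) :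
  boxes T r c = T (Ordinal rj) (Ordinal cm).
Proof. by rewrite -boxesE. Qed.

Definition first_top X := find (fun c => X j.-1 c == n.+1) (iota 0 m).

Lemma first_top_le X : first_top X <= m.
Proof. by rewrite -[X in _ <= X](size_iota 0) find_size. Qed.

Lemma boxes_punctured (T : 'M[nat]_(j, m)) : ssyt n T ->
  punctured (boxes T) j 0 0 (first_top (boxes T)).
Proof.
case=> Hrange Hrow Hcol; set X := boxes T.
have range r c : r < j -> c < m -> 1 <= X r c <= n.+1.
  by move=> rj cm; rewrite /X boxes_lt.
have row r k k' : r < j -> k < k' < m -> X r k <= X r k'.
  move=> rj /andP[kk' km']; rewrite /X (boxes_lt _ rj (ltn_trans kk' km')).
  by rewrite (boxes_lt _ rj km'); apply: Hrow; apply: ltnW.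
have col q q' k : q < q' < j -> k < m -> X q k < X q' k.
  move=> /andP[qq' qj'] km; rewrite /X (boxes_lt _ (ltn_trans qq' qj') km).
  by rewrite (boxes_lt _ qj' km); apply: Hcol.
split.
- by move=> q k k' qj kk' _ _; apply: row.
- by move=> q q' k qq' km _ _; apply: col.
- by move=> q k qj km _; have := range q k qj km; lia.
- move=> q k qj km _; have [qE|qE] := eqVneq q.+1 j; last first.
    by have := col q q.+1 k; have := range q.+1 k; lia.
  have -> : q = j.-1 by lia.
  have jj : j.-1 < j by lia.
  have top0 c : c < first_top X -> (X j.-1 c == n.+1) = false.
    move=> h; have := before_find 0 h; rewrite nth_iota //.
    exact: leq_trans h (first_top_le X).
  have [ek|ek] := leqP (first_top X) k; last exact: top0.
  have em : first_top X < m by apply: leq_ltn_trans km.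
  have : has (fun c => X j.-1 c == n.+1) (iota 0 m).
    by rewrite has_find size_iota.
  move/(nth_find 0); rewrite nth_iota // -/(first_top X) add0n => /eqP xe.
  case: (ltngtP (first_top X) k) ek => [ek _||<- _] //; last by rewrite xe eqxx.
  by have := row j.-1 (first_top X) k jj; have := range j.-1 k jj km; lia.
- by move=> q k qj km _; have := range q k qj km; lia.
Qed.

Lemma remove_and_shift_agree (T : 'M[nat]_(j, m)) : ssyt n T ->
  agree (remove_and_shift n T) (boxes T).
Proof.
move=> [Hrange _ _] r c rj cm; rewrite boxes_lt /remove_and_shift !insubT /shown.
have := Hrange (Ordinal rj) (Ordinal cm).
case: (T _ _) => //= x _; by [].
Qed.

Lemma empty_boxes_last_row X Tf e : 0 < j -> punctured X j 0 0 e -> e <= m ->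
  agree Tf X ->
  empty_boxes j m Tf = [seq (j.-1, c) | c <- iota e (m - e)].
Proof.
move=> j0 [_ _ H0 Ht _] em A.
have emptyE r c : r < j -> c < m -> (Tf r c == None) = (r.+1 == j) && (e <= c).
  move=> rj cm; rewrite A // /shown H0 ?Ht //; last lia; last lia.
  have -> (b : bool) x : ((if b then None else Some x) == None :> option nat) = b.
    by case: b.
  by rewrite ltn0 andbF.
have colE c : c < m ->
    [seq b <- [seq (r, c) | r <- iota 0 j] | Tf b.1 b.2 == None] =
    if e <= c then [:: (j.-1, c)] else [::].
  move=> cm; rewrite -{1}(prednK j0) -addn1 iotaD map_cat filter_cat /= add0n.
  rewrite (_ : filter _ _ = [::]); last first.
    apply/eqP; rewrite -[_ == _]negbK -has_filter; apply/hasPn => b.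
    case/mapP => r; rewrite mem_iota => rj -> /=; rewrite emptyE //; lia.
  rewrite emptyE //; last lia.
  by have -> : (j.-1.+1 == j) by lia.
have -> : empty_boxes j m Tf =
    flatten [seq if e <= c then [:: (j.-1, c)] else [::] | c <- iota 0 m].
  rewrite /empty_boxes filter_flatten -map_comp; congr flatten.
  by apply/eq_in_map => c; rewrite mem_iota => cm /=; apply: colE.
rewrite -[in LHS](subnKC em) iotaD map_cat flatten_cat add0n.
rewrite (_ : flatten _ = [::]) ?cat0s; last first.
  rewrite (_ : map _ _ = [seq [::] | c <- iota 0 e]); last first.
    by apply/eq_in_map => c; rewrite mem_iota => ce; rewrite ifF //; lia.
  by elim: (iota 0 e).
rewrite (_ : map _ _ = [seq [:: (j.-1, c)] | c <- iota e (m - e)]); last first.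
  by apply/eq_in_map => c; rewrite mem_iota => /andP[-> _].
by elim: (iota e (m - e)) => //= c l ->.
Qed.

(** The slides are followed together with a state on which the upward moves act
    by [up] and the erasure of a letter [n + 1] by [sh]. The states will be
    modules, [up r] being T_r; a trivial state gives the facts about tableaux
    alone. *)
Section Simulation.
Variables (S : Type) (up : nat -> S -> S) (sh : S -> S).
Variable rel : S -> (nat -> nat -> nat) -> Prop.
Hypothesis rel_left : forall N X r c, rel N X ->
  r < j -> 0 < c < m -> X r c = 0 -> rel N (move_letter X r c r c.-1).
Hypothesis rel_up : forall N X r c z e, rel N X ->
  punctured X r c z e -> 0 < r < j -> c < m -> c < e -> z <= c -> X r c = 0 ->
  (0 < c -> X r c.-1 <= X r.-1 c) -> rel (up r N) (move_letter X r c r.-1 c).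
Hypothesis rel_top : forall N X c, rel N X -> c < m -> X j.-1 c = n.+1 ->
  rel (sh N) (update X j.-1 c 0).

(** The outcome of a slide that starts at (r, c) when [z] zeros are present. The
    last clause is needed to see that the new barrier, built row by row while
    the empty box goes up, is not altered by the rest of the path. *)
Definition slid X Tf' N r c z e :=
  exists X' b', [/\ punctured X' j 0 (b' 0) e, b' 0 = z.+1 & b' r <= c.+1] /\
    [/\ barrier b' X' r, agree Tf' X', rel (foldr up N (iota 1 r)) X' &
      forall q k, (r < q) || (q == r) && (c < k) -> X' q k = X q k].

(** Induction on the moves. The barrier of the previous slide keeps the empty
    box in the columns from [b r] on; in the first row, it stops exactly at
    column [b 0], next to the zeros. *)
Lemma slide_simulation fuel Tf X N r c b e :
    punctured X r c (b 0) e -> r < j -> c < m -> c < e -> X r c = 0 ->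
    b r <= c -> barrier b X r -> agree Tf X -> rel N X -> r + c <= fuel ->
  slid X (slide fuel Tf r c) N r c (b 0) e.
Proof.
elim: fuel Tf X N r c => [|fuel IH] Tf X N r c P rj cm ce Xrc bc B A RN le.
  have [r0 c0] : r = 0 /\ c = 0 by lia.
  subst r c; have b0 : b 0 = 0 by lia.
  exists X, (fun=> 1); rewrite b0 in P *; split; split=> //.
    exact: punctured_end P.
  by move=> q; lia.
have bmono := barrier_mono B.
have br : b 0 <= b r by apply: bmono; rewrite leqnn.
have [Hr Hc H0 Ht Hl] := P.
have leftE : left_box Tf r c = if c == 0 then None else shown (X r c.-1).
  by rewrite -A //; [case: (c) | lia].
have upE : upper_box Tf r c = if r == 0 then None else shown (X r.-1 c).
  by rewrite -A //; [case: (r) | lia].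
have leftS : 0 < c -> (r == 0) ==> (b 0 < c) -> left_box Tf r c = Some (X r c.-1).+1.
  move=> c0 rz; rewrite leftE /shown ifF; last lia.
  by rewrite H0 ?Ht; [rewrite ifF //; lia | lia..].
have upS : 0 < r -> upper_box Tf r c = Some (X r.-1 c).+1.
  move=> r0; rewrite upE /shown ifF; last lia.
  by rewrite H0 ?Ht; [rewrite ifF //; lia | lia..].
(* this never happens at column [b r]: the barrier forces an upward move *)
have goleft : 0 < c -> (r == 0) ==> (b 0 < c) -> (0 < r -> X r.-1 c < X r c.-1) ->
  slid X (slide fuel (set_box (set_box Tf r c (Some (X r c.-1).+1)) r c.-1 None)
             r c.-1) N r c (b 0) e.
  move=> c0 rz lt; have bc1 : b r <= c.-1.
    have [r0|r0] := posnP r; first by move: rz; rewrite r0 /=; lia.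
    have [|_ bX] := B r; first lia.
    rewrite leqNgt; apply/negP => h.
    have bE : b r = c by lia.
    by move: bX lt; rewrite bE; lia.
  have B' : barrier b (move_letter X r c r c.-1) r.
    move=> q qr; have [b1 b2] := B q qr; split=> // bq.
    rewrite !move_letter_out; [exact: b2 |
      by move: bq; case: (eqVneq q r) => [->|] *; lia..].
  have := IH (set_box (set_box Tf r c (Some (X r c.-1).+1)) r c.-1 None)
    (move_letter X r c r c.-1) N r c.-1.
  case; rewrite ?move_letter_hole //; try lia.
  - by apply: punctured_left P _ _ _ _ _ => //; lia.
  - apply: agree_move => //; first lia.
    by move: (leftS c0 rz); case: (c) c0.
  - by apply: rel_left => //; lia.
  move=> X' [b' [[P' b0' br'] [B'' A' R' out]]]; exists X', b'; split; split=> //.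
    lia.
  by move=> q k qk; rewrite out ?move_letter_out //; lia.
(* the exit from row [r] at column [c] is recorded in the new barrier *)
have goup : 0 < r -> (0 < c -> X r c.-1 <= X r.-1 c) ->
  slid X (slide fuel (set_box (set_box Tf r c (Some (X r.-1 c).+1)) r.-1 c None)
             r.-1 c) N r c (b 0) e.
  move=> r0 ge.
  have B' : barrier b (move_letter X r c r.-1 c) r.-1.
    move=> q qr; have [|b1 b2] := B q; first lia.
    split=> // bq; have bqr : b q <= b r by apply: bmono; lia.
    by rewrite !move_letter_out; [exact: b2 | lia..].
  have := IH (set_box (set_box Tf r c (Some (X r.-1 c).+1)) r.-1 c None)
    (move_letter X r c r.-1 c) (up r N) r.-1 c.
  case; rewrite ?move_letter_hole //; try lia.
  - by apply: punctured_up P _ _ _ _ _ => //; lia.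
  - by apply: leq_trans bc; apply: bmono; lia.
  - apply: agree_move => //; first lia.
    by move: (upS r0); case: (r) r0.
  - by apply: rel_up P _ _ _ _ _ _ => //; lia.
  move=> X' [b' [[P' b0' br'] [B'' A' R' out]]].
  exists X', (fun q => if q == r then c.+1 else b' q).
  have -> : (0 == r) = false by lia.
  split; split=> //.
  - by rewrite eqxx.
  - move=> q qr; have -> : (q.-1 == r) = false by lia.
    case: (eqVneq q r) => [qE|qr']; last by apply: B''; lia.
    subst q; split; first lia.
    move=> cm1; rewrite (out r c) ?(out r.-1 c.+1); try lia.
    rewrite [X in X <= _]move_letterE ?eqxx; last by lia.
    by rewrite move_letter_out; [apply: Hr | |]; lia.
  - have -> : r = r.-1 + 1 by lia.
    by rewrite iotaD foldr_cat /= add1n prednK // addn1 prednK.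
  by move=> q k qk; rewrite out ?move_letter_out //; lia.
rewrite /=; have [r0|r0] := posnP r.
  have -> : upper_box Tf r c = None by rewrite upE r0.
  have [cb|cb] := ltnP (b 0) c.
    by rewrite leftS; [apply: goleft; lia | lia..].
  have cE : c = b 0 by move: bc; rewrite r0; lia.
  have -> : left_box Tf r c = None.
    rewrite leftE; case: eqP => // c0; rewrite /shown ifT // H0; lia.
  subst r c; exists X, (fun=> (b 0).+1); split; split=> //.
    exact: punctured_end P.
  by move=> q; lia.
rewrite upS //; have [c0|c0] := posnP c.
  have -> : left_box Tf r c = None by rewrite leftE c0.
  by apply: goup => //; lia.
rewrite leftS //; last lia.
by case: ifP => h; [apply: goup | apply: goleft]; lia.
Qed.

Definition promote N := foldr up (sh N) (iota 1 j.-1).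

(** In the last row, the empty boxes are processed from left to right. The slide
    of the box at column [e + p] ends its stay in that row at a column at most
    [e + p], hence the next one starts on the right of the barrier. *)
Lemma slides_simulation Tf X N e p : 0 < j ->
    punctured X j 0 0 e -> agree Tf X -> rel N X -> e + p <= m ->
  exists X' b, [/\ punctured X' j 0 p (e + p), b 0 = p, b j.-1 <= e + p,
    barrier b X' j.-1 &
    agree (foldl slide_box Tf [seq (j.-1, c) | c <- iota e p]) X' /\
    rel (iter p promote N) X'].
Proof.
move=> j0 P A RN; elim: p => [|p IHp] ep.
  exists X, (fun=> 0); rewrite addn0; split=> //; split.
have [|X1 [b1 [P1 b0 b1j B1 [A1 R1]]]] := IHp; first lia.
have [Hr Hc H0 Ht Hl] := P1.
pose X2 := update X1 j.-1 (e + p) 0.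
have X2E q k : (q != j.-1) || (k != e + p) -> X2 q k = X1 q k.
  by move=> ne; rewrite /X2 /update ifF //; lia.
have X2h : X2 j.-1 (e + p) = 0 by rewrite /X2 /update !eqxx.
have top : X1 j.-1 (e + p) = n.+1 by apply/eqP; rewrite Ht; lia.
have P2 : punctured X2 j.-1 (e + p) (b1 0) (e + p).+1.
  rewrite b0; split.
  - by move=> q k k' *; rewrite !X2E //; apply: Hr; lia.
  - by move=> q q' k *; rewrite !X2E //; apply: Hc; lia.
  - by move=> q k *; rewrite !X2E //; apply: H0; lia.
  - by move=> q k *; rewrite X2E ?Ht; lia.
  - by move=> q k *; rewrite X2E //; apply: Hl; lia.
have R2 : rel (sh (iter p promote N)) X2 by apply: rel_top => //; lia.
have A2 : agree (foldl slide_box Tf [seq (j.-1, c) | c <- iota e p]) X2.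
  move=> r c rj cm; rewrite A1 // /X2 /update; case: ifP => // /andP[/eqP-> /eqP->].
  by rewrite top /shown eqxx orbT.
have B2 : barrier b1 X2 j.-1.
  move=> q qj; have [b2 b3] := B1 q qj; split=> // bq.
  have bqj : b1 q <= b1 j.-1 by apply: barrier_mono B1 _; lia.
  by rewrite !X2E; [apply: b3 | |]; lia.
have := slide_simulation P2 _ _ _ X2h b1j B2 A2 R2 (leqnn _).
case; try lia.
move=> X' [b' [[P' b0' br'] [B' A' R' _]]]; exists X', b'.
rewrite b0' b0 in P'; rewrite addnS b0' b0; split=> //; split=> //.
by rewrite -addn1 iotaD map_cat foldl_cat /=.
Qed.

Lemma promotion_simulation (T : 'M[nat]_(j, m)) N : 0 < j -> ssyt n T ->
    rel N (boxes T) ->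
  exists X, [/\ exists z, punctured X j 0 z m,
    forall (r : 'I_j) (c : 'I_m), pr_tab n T r c = (X r c).+1 &
    rel (iter (m - first_top (boxes T)) promote N) X].
Proof.
move=> j0 sT RN; set e := first_top _.
have em : e <= m by apply: first_top_le.
have P := boxes_punctured sT; have A := remove_and_shift_agree sT.
have [|X [b [PX b0 bj B [AX RX]]]] :=
  slides_simulation (p := m - e) j0 P A RN.
  by rewrite subnKC.
rewrite subnKC // in PX; exists X; split=> //; first by exists (m - e).
move=> r c; rewrite mxE (empty_boxes_last_row j0 P em A) -/e AX // /shown.
have [_ _ _ Ht _] := PX.
rewrite Ht //; last by rewrite neq_ltn ltn_ord.
rewrite leqNgt ltn_ord andbF orbF.
by case: eqP => [->|].
Qed.

End Simulation.

Lemma ssyt_succ (T : 'M[nat]_(j, m)) X z : punctured X j 0 z m ->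
    (forall (r : 'I_j) (c : 'I_m), T r c = (X r c).+1) ->
  ssyt n T.
Proof.
move=> [Hr Hc H0 Ht Hl] TE; split.
- move=> r c; rewrite TE /= ltnS.
  have rj : (r != j :> nat) || (c != 0 :> nat) by rewrite neq_ltn ltn_ord.
  have := Ht r c (ltn_ord r) (ltn_ord c) rj; have := Hl r c (ltn_ord r) (ltn_ord c) rj.
  by have := ltn_ord c; lia.
- move=> r c c'; rewrite leq_eqVlt !TE => /orP[/eqP->//|lt].
  by have := ltn_ord c'; have := ltn_ord r; have := Hr r c c'; lia.
move=> r r' c lt; rewrite !TE.
by have := ltn_ord c; have := ltn_ord r'; have := Hc r r' c; lia.
Qed.

Lemma pr_tab_ssyt (T : 'M[nat]_(j, m)) : 0 < j -> ssyt n T -> ssyt n (pr_tab n T).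
Proof.
move=> j0 sT.
have [//|//|//|X [[z P] TE _]] := promotion_simulation (S := unit)
  (up := fun _ => id) (sh := id) (rel := fun _ _ => True) _ _ _ (N := tt)
  j0 sT I.
exact: ssyt_succ P TE.
Qed.

End Slides.

(** * Modules whose multiplicities spell a tableau *)

Section Letters.
Variables (n j m : nat).
Implicit Types (X : nat -> nat -> nat) (r c z e q k : nat).

Definition letters X r s := \sum_(c < m) (X r c == s).

Lemma letters_update X r c x s : c < m ->
  letters (update X r c x) r s + (X r c == s) = letters X r s + (x == s).
Proof.
move=> cm; rewrite /letters [in LHS](bigD1 (Ordinal cm)) //=.
rewrite [in RHS](bigD1 (Ordinal cm)) //=.
rewrite /update !eqxx /=.
rewrite (eq_bigr (fun k : 'I_m => nat_of_bool (X r k == s))) => [|k kc]; first lia.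
by rewrite ifF //; move: kc; rewrite -val_eqE /=; lia.
Qed.

Lemma letters_update_out X r c x q s : q != r ->
  letters (update X r c x) q s = letters X q s.
Proof.
by move=> qr; apply: eq_bigr => k _; rewrite /update (negbTE qr).
Qed.

Lemma letters_top X e : 0 < j -> punctured n j m X j 0 0 e -> e <= m ->
  letters X j.-1 n.+1 = m - e.
Proof.
move=> j0 [_ _ _ Ht _] em.
transitivity (\sum_(c < m) (e <= c)).
  apply: eq_bigr => c _; have -> : (X j.-1 c == n.+1) = (e <= c) by rewrite Ht ?prednK ?eqxx //; lia.
  by [].
rewrite -(big_mkord xpredT (fun c => nat_of_bool (e <= c))).
rewrite (@big_cat_nat _ _ _ e) //= big_nat big1 ?add0n; last first.
  by move=> c /andP[_ ce]; rewrite leqNgt ce.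
rewrite big_nat; under eq_bigr => c /andP[-> _] do [].
by rewrite -big_nat sum_nat_const_nat muln1.
Qed.

Lemma sum_eq_range a b x : \sum_(a <= k < b) (x == k) = (a <= x < b).
Proof.
elim: b => [|b IHb]; first by rewrite big_geq // ltn0 andbF.
case: (leqP a b) => ab; last by rewrite big_geq //; lia.
by rewrite big_nat_recr //= IHb; lia.
Qed.

End Letters.

Section ModulePromotion.
Variables (K : fieldType) (n j m : nat).
Implicit Types (X : nat -> nat -> nat) (r c z e q k i s : nat).
Implicit Types (N : rep K (quiverA n.+1)).

(** Letters smaller than their row number do not correspond to any M(i,s); they
    appear during the slides (a letter i brought down from row i to row i + 1)
    and are matched by the convention that E_N = 0 when s_0 = i. *)
Definition spells N X := forall i s, 0 < i <= j -> i <= s <= n.+1 ->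
  mu N i s = letters m X i.-1 s.

Lemma spells_left N X r c : spells N X ->
  r < j -> 0 < c < m -> X r c = 0 -> spells N (move_letter X r c r c.-1).
Proof.
move=> NX rj cm Xrc i s ij si; rewrite NX //.
have [iE|iE] := eqVneq i.-1 r; last by rewrite !letters_update_out.
have := @letters_update m (update X r c (X r c.-1)) r c.-1 0 s.
have := @letters_update m X r c (X r c.-1) s.
rewrite iE -/(move_letter X r c r c.-1) {2}/update Xrc [c.-1 == c]ltn_eqF ?andbF; lia.
Qed.

Lemma spells_top N X c : 0 < j <= n.+1 -> spells N X -> c < m -> X j.-1 c = n.+1 ->
  spells (shmod j N) (update X j.-1 c 0).
Proof.
move=> jn NX cm Xc i s ij si.
have E r := @letters_update m X j.-1 c 0 r cm.
have NE := NX j n.+1; have E1 := E n.+1; have E2 := E s.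
rewrite Xc eqxx in E1; rewrite Xc in E2.
rewrite /shmod mu_remove; try lia.
have [iE|iE] := eqVneq i j; last by rewrite NX // letters_update_out //; lia.
subst i; rewrite NX //= ?[s == _]eq_sym; lia.
Qed.

Lemma s_max_eq p i s0 (N : rep K (quiverA p)) : i <= s0 <= p ->
    (forall t, i <= t <= p -> (Fvee N i t <= Fvee N i s0)%R) ->
    (forall t, s0 < t <= p -> (Fvee N i t < Fvee N i s0)%R) ->
  s_max i N = s0.
Proof.
move=> is0 le lt; apply/eqP; rewrite eqn_leq; apply/andP; split.
  apply/bigmax_leqP_seq => t; rewrite mem_index_iota => tp /allP max_t.
  rewrite leqNgt; apply/negP => s0t.
  have := max_t s0; rewrite mem_index_iota => /(_ _); rewrite leNgt lt; lia.
apply: (@leq_bigmax_seq _ _ _ id); first by rewrite mem_index_iota; lia.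
by apply/allP => t; rewrite mem_index_iota => tp; apply: le; lia.
Qed.

Definition above (f : nat -> nat) s := \sum_(c < m) (s <= f c).

Lemma sum_letters X r a b :
  \sum_(a <= s < b) letters m X r s = \sum_(c < m) (a <= X r c < b).
Proof.
by rewrite exchange_big /=; apply: eq_bigr => c _; rewrite sum_eq_range.
Qed.

Lemma Fvee_spells N X r s : spells N X -> 0 < r < j -> r <= s <= n.+1 ->
    (forall c, c < m -> X r.-1 c <= n.+1) -> (forall c, c < m -> X r c <= n.+1) ->
  Fvee N r s = ((above (X r.-1) s)%:Z - (above (X r) s.+1)%:Z)%R.
Proof.
move=> NX rj rs le1 le2.
have PoszS := big_morph Posz PoszD (erefl (Posz 0)).
rewrite /Fvee -!PoszS; congr (_%:Z - _%:Z)%R.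
  transitivity (\sum_(s <= k < n.+2) letters m X r.-1 k).
    by rewrite big_nat [RHS]big_nat; apply: eq_bigr => k kn; rewrite NX //; lia.
  rewrite sum_letters; apply: eq_bigr => c _; have := le1 c (ltn_ord c); lia.
transitivity (\sum_(s.+1 <= k < n.+2) letters m X r k).
  rewrite big_add1 /= big_nat [RHS]big_nat; apply: eq_bigr => k kn.
  by rewrite NX //; lia.
rewrite sum_letters; apply: eq_bigr => c _; have := le2 c (ltn_ord c); lia.
Qed.

Lemma sum_eq_ord (c : nat) : c < m -> \sum_(k < m) (k == c :> nat) = 1.
Proof.
by move=> cm; rewrite -(big_mkord xpredT (fun k => nat_of_bool (k == c)))
  (eq_bigr (fun k => nat_of_bool (c == k))) ?sum_eq_range ?cm // => k _; rewrite eq_sym.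
Qed.

(** Compare F_r(s) with 1 column by column. A column k other than c satisfies
    X (r-1) k < X r k, so it contributes at most 0, and column c at most 1. For s
    beyond the letter above the empty box, column c and those on its left
    contribute at most 0. At that letter, the columns left of c contribute 0
    because X r k <= X r (c-1) is at most this letter, column c contributes 1,
    and the columns right of c contribute 0. *)
Lemma s_max_spells N X r c z e : spells N X ->
  punctured n j m X r c z e -> 0 < r < j -> c < m -> c < e -> z <= c -> X r c = 0 ->
  (0 < c -> X r c.-1 <= X r.-1 c) ->
  r <= X r.-1 c <= n /\ s_max r N = X r.-1 c.
Proof.
move=> NX P rj cm ce zc Xrc left; have [Hr Hc H0 Ht Hl] := P.
set s0 := X r.-1 c.
(* column c is strict above the empty box, and it starts with a letter >= 1 *)
have s0r : r <= s0.
  suff : forall q, q < r -> q < X q c by move/(_ r.-1); lia.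
  elim=> [|q IHq] qr; first by have := H0 0 c; lia.
  by have := Hc q q.+1 c; have := IHq; lia.
have s0n : s0 <= n by have := Ht r.-1 c; have := Hl r.-1 c; lia.
split; first by rewrite s0r.
have le1 k : k < m -> X r.-1 k <= n.+1 by move=> km; apply: Hl; lia.
have le2 k : k < m -> X r k <= n.+1.
  by move=> km; have [->|kc] := eqVneq k c; [rewrite Xrc | apply: Hl; lia].
have FE s (h : r <= s <= n.+1) := Fvee_spells NX rj h le1 le2.
have below k : k < m -> k != c -> X r.-1 k < X r k by move=> *; apply: Hc; lia.
have U1 s : above (X r.-1) s <= above (X r) s.+1 + 1.
  rewrite -(sum_eq_ord cm) -big_split /=; apply: leq_sum => k _.
  by have := below k (ltn_ord k); case: (eqVneq (k : nat) c) => ? ?; lia.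
have U0 s : s0 < s -> above (X r.-1) s <= above (X r) s.+1.
  move=> s0s; apply: leq_sum => k _.
  have := below k (ltn_ord k); have := Hr r.-1 k c; have := ltn_ord k.
  case: (eqVneq (k : nat) c) => [->|?]; rewrite -/s0; lia.
have L1 : above (X r) s0.+1 + 1 <= above (X r.-1) s0.
  rewrite -(sum_eq_ord cm) -big_split /=; apply: leq_sum => k _.
  have [->|kc] := eqVneq (k : nat) c; first by rewrite Xrc -/s0; lia.
  case: (ltnP k c) => kc'.
    suff : X r k <= s0 by lia.
    apply: leq_trans (left _); last by lia.
    have [->//|k1] := eqVneq (k : nat) c.-1.
    by apply: Hr; lia.
  have : s0 <= X r.-1 k by apply: Hr; have := ltn_ord k; lia.
  by have := ltn_ord k; lia.
apply: s_max_eq; first lia.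
  by move=> t tn; rewrite !FE; [have := U1 t; lia | lia..].
by move=> t tn; rewrite !FE; [have := U0 t; lia | lia..].
Qed.

Lemma spells_up N X r c z e : j <= n.+1 -> spells N X ->
  punctured n j m X r c z e -> 0 < r < j -> c < m -> c < e -> z <= c -> X r c = 0 ->
  (0 < c -> X r c.-1 <= X r.-1 c) -> spells (Tmod r N) (move_letter X r c r.-1 c).
Proof.
move=> jn NX P rj cm ce zc Xrc left i s ij si.
have [s0r sE] := s_max_spells NX P rj cm ce zc Xrc left.
rewrite /Tmod sE.
have E1 t := @letters_update m X r c (X r.-1 c) t cm.
have E2 t := @letters_update m (update X r c (X r.-1 c)) r.-1 c 0 t cm.
have upE : update X r c (X r.-1 c) r.-1 c = X r.-1 c.
  by rewrite /update ifF //; lia.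
rewrite /move_letter.
have NrX := NX r (X r.-1 c).
have letX : 0 < letters m X r.-1 (X r.-1 c).
  by rewrite /letters (bigD1 (Ordinal cm)) //= eqxx.
rewrite mu_exchange; try lia.
have -> : mu (if X r.-1 c == r then rep0 K (quiverA n.+1)
             else Mrs K n.+1 r.+1 (X r.-1 c)) i s = (i == r.+1) && (s == X r.-1 c).
  case: eqP => [cr|cr]; last by rewrite mu_Mrs; lia.
  rewrite mu_rep0; lia.
have [iE|iE] := eqVneq i r.
  subst i; have := E2 s; rewrite upE [letters _ (update X _ _ _) r.-1 s]letters_update_out.
    by rewrite NX //; lia.
  lia.
rewrite letters_update_out; last lia.
have [iE'|iE'] := eqVneq i r.+1.
  subst i; have := E1 s; rewrite Xrc NX //=; lia.
rewrite letters_update_out ?NX //; lia.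
Qed.

End ModulePromotion.

(** * The set B^h(lambda) and semistandard tableaux *)

Section Weight.
Variables (K : fieldType) (n j m : nat).
Hypotheses (hj : 0 < j) (hjn : j <= n).
Implicit Types (M N : rep K (quiverA n)) (T : 'M[nat]_(j, m)) (r c q k i s : nat).

Definition tail M i s := \sum_(s <= k < n.+1) mu M i k.

Lemma Fvee_tail M i s : s <= n ->
  Fvee M i s = ((tail M i s)%:Z - (tail M i.+1 s.+1)%:Z)%R.
Proof.
move=> sn; have PoszS := big_morph Posz PoszD (erefl (Posz 0)).
by rewrite /Fvee -!PoszS /tail big_add1.
Qed.

Lemma tail_recl M i s : s <= n -> tail M i s = mu M i s + tail M i s.+1.
Proof. by move=> sn; rewrite /tail big_ltn. Qed.

(** For i < j the inequality says that the letters at least s + 1 of row i lie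
    above letters at least s + 2 of row i + 1. For i > j it forces the
    multiplicities to vanish, and then, for i = j, it says that row j has at most
    m letters larger than j. *)
Lemma Bh_tail M :
  Bh (rect_weight m j) M <->
  forall i s, 0 < i -> i <= s -> s <= n ->
    tail M i s <= (i == j) * m + tail M i.+1 s.+1.
Proof.
split=> h i s i0 si sn; move: (h i s i0 si sn);
  rewrite Fvee_tail // /rect_weight /fund_weight.
  case: (i == j) => /=; rewrite ?mulr1n ?mul0rn; lia.
case: (i == j) => /=; rewrite ?mulr1n ?mul0rn; lia.
Qed.

Section Tails.
Variable M : rep K (quiverA n).
Hypothesis BM : Bh (rect_weight m j) M.

(** Iterating the inequality moves the tail up to an empty sum. *)
Lemma tail_below i s : j < i -> i <= s -> tail M i s = 0.
Proof.
suff : forall d i s, j < i -> i <= s -> n < s + d -> tail M i s = 0.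
  by move=> h ji si; apply: (h n.+1) => //; lia.
elim=> [|d IHd] {}i {}s ji si nd; first by rewrite /tail big_geq //; lia.
case: (leqP s n) => sn; last by rewrite /tail big_geq //; lia.
have /Bh_tail/(_ i s) := BM; rewrite (IHd i.+1 s.+1); try lia.
Qed.

Lemma tail_le i s d : 0 < i -> i + d <= j -> i <= s ->
  tail M i s <= tail M (i + d) (s + d).
Proof.
elim: d => [|d IHd] i0 ij si; first by rewrite !addn0.
apply: leq_trans (IHd _ _ _) _; try lia.
case: (leqP (s + d) n) => sn; last by rewrite /tail big_geq //; lia.
have /Bh_tail/(_ (i + d) (s + d)) := BM; rewrite !addnS.
have -> : (i + d == j) = false by lia.
lia.
Qed.

Lemma tail_le_m i s : 0 < i <= j -> i <= s -> tail M i s <= m.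
Proof.
move=> ij si; apply: leq_trans (@tail_le i s (j - i) _ _ _) _; try lia.
case: (leqP (s + (j - i)) n) => sn; last by rewrite /tail big_geq //; lia.
have /Bh_tail/(_ (i + (j - i)) (s + (j - i))) := BM.
rewrite [tail M _.+1 _]tail_below; lia.
Qed.

Lemma tail_high i s : 0 < i <= j -> i <= s -> n - j + i < s -> tail M i s = 0.
Proof.
move=> ij si sn; apply/eqP; rewrite -leqn0.
apply: leq_trans (@tail_le i s (j - i) _ _ _) _; try lia.
by rewrite /tail big_geq //; lia.
Qed.

End Tails.

(** In a weakly increasing row, comparing one box with a value amounts to
    counting; hence both columnwise inequalities and equality of rows
    can be checked on letter counts. *)
Lemma above_monotone (f : nat -> nat) v c :
  (forall k k', k < k' < m -> f k <= f k') -> c < m ->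
  (v <= f c) = (m - c <= above m f v).
Proof.
move=> mono cm; rewrite /above -(big_mkord xpredT (fun c => nat_of_bool (v <= f c))).
rewrite (@big_cat_nat _ _ _ c) ?(ltnW cm) //=.
apply/idP/idP => [vc|].
  apply: leq_trans (leq_addl _ _); rewrite -[m - c]muln1 -sum_nat_const_nat.
  rewrite !big_nat; apply: leq_sum => k kc.
  have [->|ck] := eqVneq k c; first by rewrite vc.
  by rewrite (leq_trans vc) //; apply: mono; lia.
apply: contraTT; rewrite -!ltnNge => fc.
rewrite big_nat big1 => [|k kc]; last by have := mono k c; lia.
rewrite add0n big_ltn //; have -> : (v <= f c) = false by lia.
rewrite add0n; apply: leq_ltn_trans (_ : _ <= m - c.+1) _; last lia.
rewrite -[m - c.+1]muln1 -sum_nat_const_nat; apply: leq_sum => k _.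
exact: leq_b1.
Qed.

Definition matches M T := forall r s, r < j -> r < s <= n ->
  letters m (boxes T) r s.+1 = mu M r.+1 s.

Lemma ssyt_lower T r c : ssyt n T -> r < j -> c < m -> r < boxes T r c.
Proof.
move=> [Hrange _ Hcol] rj cm; elim: r rj => [|r IHr] rj.
  by rewrite (boxes_lt _ rj cm); have /andP[] := Hrange (Ordinal rj) (Ordinal cm).
apply: leq_ltn_trans (IHr (ltnW rj)) _.
by rewrite (boxes_lt _ (ltnW rj) cm) (boxes_lt _ rj cm); apply: Hcol.
Qed.

Lemma ssyt_upper T r c : ssyt n T -> r < j -> c < m ->
  boxes T r c + (j - r.+1) <= n.+1.
Proof.
move=> [Hrange _ Hcol] rj cm.
suff : forall d, r + d < j -> boxes T r c + d <= boxes T (r + d) c.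
  move=> /(_ (j - r.+1)) h; apply: leq_trans (h _) _; first lia.
  have rj' : r + (j - r.+1) < j by lia.
  by rewrite (boxes_lt _ rj' cm); have /andP[] := Hrange (Ordinal rj') (Ordinal cm).
elim=> [|d IHd] rd; first by rewrite !addn0.
rewrite !addnS in rd *; have rd' : r + d < j by lia.
apply: leq_ltn_trans (IHd rd') _.
by rewrite (boxes_lt _ rd' cm) (boxes_lt _ rd cm); apply: Hcol.
Qed.

Lemma matches_above M T r s : ssyt n T -> matches M T -> r < j -> r < s ->
  above m (boxes T r) s.+1 = tail M r.+1 s.
Proof.
move=> sT MT rj rs.
transitivity (\sum_(s.+1 <= k < n.+2) letters m (boxes T) r k).
  rewrite sum_letters; apply: eq_bigr => c _.
  have := ssyt_upper sT rj (ltn_ord c); lia.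
rewrite big_add1 /= /tail big_nat [RHS]big_nat; apply: eq_bigr => k kn.
by rewrite MT //; lia.
Qed.

Lemma ssyt_row_le T r k k' : ssyt n T -> r < j -> k < k' < m ->
  boxes T r k <= boxes T r k'.
Proof.
move=> [_ Hrow _] rj /andP[kk' km']; have km := ltn_trans kk' km'.
by rewrite (boxes_lt _ rj km) (boxes_lt _ rj km'); apply: Hrow; apply: ltnW.
Qed.

Lemma matches_Bh M T : ssyt n T -> matches M T ->
    (forall i s, j < i -> i <= s <= n -> mu M i s = 0) ->
  Bh (rect_weight m j) M.
Proof.
move=> sT MT M0; apply/Bh_tail => i s i0 si sn.
case: (ltngtP i j) => ij /=.
- have := matches_above (r := i.-1) (s := s) sT MT.
  have := matches_above (r := i) (s := s.+1) sT MT.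
  rewrite !prednK // => <-; try lia.
  move=> <-; try lia.
  rewrite add0n; apply: leq_sum => c _.
  case: sT => _ _ Hcol; have ij' : i.-1 < j by lia.
  have := Hcol (Ordinal ij') (Ordinal ij) c; rewrite -!boxesE /=; lia.
- by rewrite /tail big_nat big1 // => k kn; apply: M0; lia.
have := matches_above (r := i.-1) (s := s) sT MT.
rewrite !prednK // => <-; try lia.
rewrite mul1n; apply: leq_trans (leq_addr _ _).
rewrite -[X in _ <= X]card_ord -sum1_card; apply: leq_sum => c _; exact: leq_b1.
Qed.

Section Phi.
Variable M : rep K (quiverA n).
Hypothesis BM : Bh (rect_weight m j) M.

Lemma sum_row r : 0 < r <= j ->
  \sum_(r <= s < (n - j + r).+1) mu M r s = tail M r r.
Proof.
move=> rj; rewrite /tail (@big_cat_nat _ _ _ (n - j + r).+1 r n.+1) //=; try lia.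
by rewrite -/(tail M r (n - j + r).+1) tail_high ?addn0 //; lia.
Qed.

Lemma size_phi_row r : 0 < r <= j -> size (phi_row m j M r) = m.
Proof.
move=> rj; rewrite size_cat size_nseq size_flatten /shape -map_comp.
rewrite sumnE big_map; under [X in _ + X]eq_bigr => s _ do rewrite /= size_nseq.
by rewrite sum_row // subnK // tail_le_m //; lia.
Qed.

Lemma phi_row_sorted r : pairwise leq (phi_row m j M r).
Proof.
have cst a x : pairwise leq (nseq a x).
  by elim: a => //= a ->; rewrite andbT; apply/allP => y /nseqP[->].
rewrite pairwise_cat cst /=; apply/andP; split.
  apply/allrelP => x y /nseqP[-> _] /flattenP[l /mapP[s]].
  by rewrite mem_index_iota => sr -> /nseqP[->]; lia.
have : pairwise ltn (index_iota r (n - j + r).+1).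
  by rewrite -(sorted_pairwise ltn_trans) iota_ltn_sorted.
elim: (index_iota _ _) => //= s l IHl /andP[sl /IHl {}IHl].
rewrite pairwise_cat cst IHl !andbT; apply/allrelP => x y /nseqP[-> _].
by move=> /flattenP[l' /mapP[s' /(allP sl) lt -> /nseqP[-> _]]]; apply: leqW.
Qed.

Lemma count_phi_row r s : 0 < r <= j -> r <= s <= n ->
  count_mem s.+1 (phi_row m j M r) = mu M r s.
Proof.
move=> rj rs; rewrite count_cat count_nseq /= [r == _]ltn_eqF ?mul0n ?add0n; last lia.
rewrite count_flatten -map_comp sumnE big_map.
transitivity (\sum_(r <= k < (n - j + r).+1) mu M r k * (s == k)).
  by apply: eq_bigr => k _; rewrite /= count_nseq /= eqSS eq_sym mulnC.
case: (leqP s (n - j + r)) => sn.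
  rewrite (bigD1_seq s) ?mem_index_iota ?iota_uniq //=; last lia.
  rewrite eqxx muln1 big1 ?addn0 // => k ks.
  by rewrite eq_sym (negbTE ks) muln0.
rewrite big_nat big1 => [|k kn]; last by rewrite [s == k]gtn_eqF ?muln0; lia.
have := tail_high BM (i := r) (s := s) rj; rewrite tail_recl; lia.
Qed.

Lemma phi_boxes r c : r < j -> c < m ->
  boxes (phi m j M) r c = nth 0 (phi_row m j M r.+1) c.
Proof. by move=> rj cm; rewrite boxes_lt mxE. Qed.

Lemma phi_row_le r k k' : r < j -> k < k' < m ->
  boxes (phi m j M) r k <= boxes (phi m j M) r k'.
Proof.
move=> rj kk'; rewrite !phi_boxes; try lia.
have /(pairwiseP 0) := phi_row_sorted r.+1.
by apply; rewrite ?inE ?size_phi_row //; lia.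
Qed.

Lemma phi_matches : matches M (phi m j M).
Proof.
move=> r s rj rs; rewrite -(@count_phi_row r.+1 s) //.
rewrite -sum1_count (big_nth 0) size_phi_row // big_mkcond big_mkord.
by apply: eq_bigr => c _; rewrite phi_boxes // /=; case: eqP.
Qed.

Lemma phi_range r c : r < j -> c < m -> r < boxes (phi m j M) r c <= n.+1.
Proof.
move=> rj cm; rewrite phi_boxes //.
have : nth 0 (phi_row m j M r.+1) c \in phi_row m j M r.+1.
  by rewrite mem_nth // size_phi_row.
rewrite mem_cat => /orP[/nseqP[-> _]|/flattenP[l /mapP[s]]]; first lia.
rewrite mem_index_iota => sr -> /nseqP[-> _]; lia.
Qed.

Lemma phi_above r s : r < j -> r < s ->
  above m (boxes (phi m j M) r) s.+1 = tail M r.+1 s.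
Proof.
move=> rj rs.
transitivity (\sum_(s.+1 <= k < n.+2) letters m (boxes (phi m j M)) r k).
  rewrite sum_letters; apply: eq_bigr => c _.
  have := phi_range rj (ltn_ord c); lia.
rewrite big_add1 /= /tail big_nat [RHS]big_nat; apply: eq_bigr => k kn.
by rewrite phi_matches //; lia.
Qed.

Lemma phi_col_lt r c : r.+1 < j -> c < m ->
  boxes (phi m j M) r c < boxes (phi m j M) r.+1 c.
Proof.
move=> rj cm; have rj' := ltnW rj.
have := phi_range rj' cm; have := phi_range rj cm.
case: (posnP (boxes (phi m j M) r c)) => [->|]; first lia.
set v := boxes _ r c => v0 v2 v1.
have [vr|vr] := eqVneq v r.+1; first lia.
have vE : v.-1.+1 = v by lia.
rewrite (above_monotone _ _ cm); last by move=> k k'; apply: phi_row_le.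
rewrite phi_above //; last lia.
have := above_monotone v (fun k k' => @phi_row_le r k k' rj') cm.
rewrite -{2}vE phi_above //; last lia.
have /Bh_tail/(_ r.+1 v.-1) := BM; rewrite vE.
have -> : (r.+1 == j) = false by lia.
by rewrite -/v leqnn; lia.
Qed.

Lemma phi_ssyt : ssyt n (phi m j M).
Proof.
split.
- move=> r c; rewrite -boxesE; have := phi_range (ltn_ord r) (ltn_ord c); lia.
- move=> r c c'; rewrite leq_eqVlt -!boxesE => /orP[/eqP->//|lt].
  by apply: phi_row_le; rewrite ?lt ?ltn_ord.
move=> r r' c lt; rewrite -!boxesE.
have := ltn_ord r'; elim: (r' : nat) lt => // q IHq; rewrite ltnS leq_eqVlt.
case/orP => [/eqP-> qj|lt qj]; first exact: phi_col_lt.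
by apply: ltn_trans (IHq lt (ltnW qj)) _; apply: phi_col_lt.
Qed.

Lemma phi_unique T : ssyt n T -> matches M T -> phi m j M = T.
Proof.
move=> sT MT; apply/matrixP => r c; rewrite -!boxesE.
have rj := ltn_ord r; have cm := ltn_ord c.
have H v : r.+1 < v -> (v <= boxes (phi m j M) r c) = (v <= boxes T r c).
  case: v => // v rv.
  rewrite (above_monotone _ _ cm); last by move=> k k'; apply: phi_row_le.
  rewrite (above_monotone _ _ cm); last by move=> k k'; apply: ssyt_row_le.
  by rewrite phi_above ?(matches_above sT MT).
have lo1 := phi_range rj cm; have lo2 := ssyt_lower sT rj cm.
have := H (boxes T r c); have := H (boxes (phi m j M) r c).
rewrite !leqnn; lia.
Qed.

End Phi.

Lemma matches_phi M T : ssyt n T -> matches M T ->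
    (forall i s, j < i -> i <= s <= n -> mu M i s = 0) ->
  Bh (rect_weight m j) M /\ phi m j M = T.
Proof.
move=> sT MT M0; have BM := matches_Bh sT MT M0.
by split; last exact: phi_unique.
Qed.

(** [kdef] counts the letters i of row i: the row has m boxes, and the letters
    larger than i are counted by the morphisms from S(i). *)
Lemma ext_spells M : Bh (rect_weight m j) M ->
  spells j m (ext_rep m j M) (boxes (phi m j M)).
Proof.
move=> BM i s ij si; have sT := phi_ssyt BM; have MT := phi_matches BM.
rewrite mu_rep_of_mults; try lia.
have ij' : i.-1 < j by lia.
have iE : i.-1.+1 = i by lia.
case: ifP => sn; last first.
  apply/esym; rewrite /letters big1 // => c _.
  have := ssyt_upper sT ij' (ltn_ord c); lia.
have [is_|is_] := eqVneq i s; last first.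
  have := MT i.-1 s.-1 ij'; rewrite iE prednK => [->|]; lia.
subst s; rewrite /kdef hom_dim_mu; try lia.
rewrite -/(tail M i i).
have := phi_above BM (r := i.-1) (s := i) ij'; rewrite iE => <-; last lia.
rewrite -[X in X - _]card_ord -sum1_card.
have -> : \sum_(c in 'I_m) 1 =
    letters m (boxes (phi m j M)) i.-1 i + above m (boxes (phi m j M) i.-1) i.+1.
  rewrite -big_split /=; apply: eq_bigr => c _.
  have := ssyt_lower sT ij' (ltn_ord c); lia.
by rewrite addnK.
Qed.

(** The slides of phi(M), followed with M^ext as state, end with the final module
    and the final tableau, one spelling the other. *)
Lemma pr_commutes M : Bh (rect_weight m j) M ->
  Bh (rect_weight m j) (pr_mod m j M) /\ phi m j (pr_mod m j M) = pr_tab n (phi m j M).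
Proof.
move=> BM; have sT := phi_ssyt BM; have P0 := boxes_punctured sT.
have spN := ext_spells BM.
have jn : j <= n.+1 by lia.
have [|||X [[z PX] TE SX]] := promotion_simulation
  (S := rep K (quiverA n.+1)) (sh := shmod j)
  (up := fun i (N : rep K (quiverA n.+1)) => Tmod i N)
  (rel := fun (N : rep K (quiverA n.+1)) X => spells j m N X) _ _ _ hj sT spN.
- by move=> N X r c; apply: spells_left.
- by move=> N X r c z e; apply: spells_up.
- by move=> N X c; apply: spells_top; rewrite hj.
have steps : mu (ext_rep m j M) j n.+1 =
    m - first_top n j m (boxes (phi m j M)).
  rewrite spN //; try lia.
  by apply: letters_top P0 _ => //; apply: first_top_le.
have sT' := ssyt_succ PX TE.
have XE r c : r < j -> c < m -> boxes (pr_tab n (phi m j M)) r c = (X r c).+1.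
  by move=> rj cm; rewrite boxes_lt TE.
have muE i s : 0 < i -> i <= s <= n -> mu (pr_mod m j M) i s =
    if (i <= j) && (s <= n - j + i) then letters m X i.-1 s else 0.
  move=> i0 si; rewrite mu_rep_of_mults //; try lia.
  case: ifP => [h|h]; case: ifP => h' //; try lia.
  rewrite /pr_tilde steps; apply: SX; lia.
apply: matches_phi => //.
- move=> r s rj rs; rewrite muE //.
  have lE : letters m (boxes (pr_tab n (phi m j M))) r s.+1 = letters m X r s.
    by apply: eq_bigr => c _; rewrite XE.
  rewrite lE; case: ifP => // h; rewrite /letters big1 // => c _.
  have := ssyt_upper sT' rj (ltn_ord c); rewrite XE //; lia.
by move=> i s ji si; rewrite muE //; [case: ifP => //; lia | lia].
Qed.

Lemma mu_eq_of_iso M M' r s : rep_iso M M' -> 0 < r -> r <= s <= n ->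
  mu M r s = mu M' r s.
Proof. by move=> MM' r0 /andP[rs sn]; apply: mu_iso. Qed.

Lemma Bh_iso M M' : rep_iso M M' -> Bh (rect_weight m j) M ->
  Bh (rect_weight m j) M'.
Proof.
move=> MM' BM.
have tE i s : 0 < i -> i <= s -> tail M' i s = tail M i s.
  move=> i0 si; rewrite /tail big_nat [RHS]big_nat; apply: eq_bigr => k kn.
  by apply/esym/mu_eq_of_iso => //; lia.
apply/Bh_tail => i s i0 si sn; rewrite !tE //.
by have /Bh_tail := BM; apply.
Qed.

Lemma phi_iso M M' : rep_iso M M' -> phi m j M = phi m j M'.
Proof.
move=> MM'; apply/matrixP => r c; rewrite !mxE; have rj := ltn_ord r.
have muE s : s \in index_iota r.+1 (n - j + r.+1).+1 -> mu M r.+1 s = mu M' r.+1 s.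
  by rewrite mem_index_iota => sr; apply: mu_eq_of_iso => //; lia.
congr (nth _ _ _); rewrite /phi_row; congr (nseq (m - _) _ ++ flatten _).
  by rewrite big_seq [RHS]big_seq; apply: eq_bigr.
by apply/eq_in_map => s /muE ->.
Qed.

Lemma ext_rep_iso M M' : rep_iso M M' -> ext_rep m j M = ext_rep m j M'.
Proof.
move=> MM'; congr rep_of_mults; apply/funext => r; apply/funext => s.
case: ifP => // rs; have [rs'|rs'] := eqVneq r s.
  rewrite /kdef !hom_dim_mu; try lia.
  congr (m - _); rewrite big_nat [RHS]big_nat; apply: eq_bigr => k kn.
  by apply: mu_eq_of_iso => //; lia.
by apply: mu_eq_of_iso => //; lia.
Qed.

End Weight.

Lemma rep_iso_refl (K : fieldType) (Q : quiver) (M : rep K Q) : rep_iso M M.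
Proof. by apply: (@rep_iso_intro _ _ M M (fun v x => x)) => // v; exists id. Qed.

Theorem theorem5 (R : realType) (n j m : nat) (hj : (1 <= j)%N) (hjn : (j <= n)%N) :
  (* the maps are well defined on isomorphism classes *)
  (forall M M' : rep R[i] (quiverA n),
     Bh (rect_weight m j) M -> rep_iso M M' ->
     [/\ Bh (rect_weight m j) M',
         rep_iso (pr_mod m j M) (pr_mod m j M')
       & phi m j M = phi m j M'])
  (* they have the indicated targets *)
  /\ (forall M : rep R[i] (quiverA n),
        Bh (rect_weight m j) M -> ssyt n (phi m j M))
  /\ (forall T : 'M[nat]_(j, m), ssyt n T -> ssyt n (pr_tab n T))
  /\ (forall M : rep R[i] (quiverA n),
        Bh (rect_weight m j) M -> Bh (rect_weight m j) (pr_mod m j M))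
  (* and the diagram commutes *)
  /\ (forall M : rep R[i] (quiverA n),
        Bh (rect_weight m j) M -> phi m j (pr_mod m j M) = pr_tab n (phi m j M)).
Proof.
split=> [M M' BM MM'|].
  split; [exact: Bh_iso BM | | exact: phi_iso].
  by rewrite /pr_mod (ext_rep_iso m hj hjn MM'); apply: rep_iso_refl.
split=> [M BM|]; first exact: phi_ssyt.
split=> [T|]; first exact: pr_tab_ssyt.
by split=> M BM; have [] := pr_commutes hj hjn BM.
Qed.
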